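(* Let $d\ge2$ be a fixed integer. For every $j=0,\dots,d-2$, every constant $\gamma>0$, every integer sequence $t=t(n)<\log^\gamma n$ with $t\to\infty$, and every integer $i\ge0$, we have $$\mathbf P(D_j(N-t)=i)=e^{-\lambda}\lambda^i/i!+o(1)\qquad(n\to\infty),$$ where $\lambda=f_j(d,t,n)=\dfrac{2[d-1]_{d-1-j}\,t}{\log^{d-1-j}n}$.
   Context: The $d$-process $\mathcal P(d,n)$ starts with the empty graph on $n$ vertices and at each step adds one edge chosen uniformly at random from all pairs of distinct vertices that are not yet edges and both of whose vertices currently have degree less than $d$; it stops when no such pair exists. $G_s$ denotes the graph when it has $s$ edges, and $D_i(s)$ is the number of vertices of degree $i$ in $G_s$. $N=\lfloor dn/2\rfloor$. The process can only stop when the vertices of degree less than $d$ form a clique (so there are at most $d$ of them); hence $G_{N-t}$ is always defined once $t>d^2$. $[x]_k=x(x-1)\cdots(x-k+1)$ is the falling factorial. Logarithms are natural. *)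

(* Defs.v *)
From HB Require Import structures.
From mathcomp Require Import all_boot all_order all_algebra.
From mathcomp Require Import reals exp.
Set Implicit Arguments.
Unset Strict Implicit.
Unset Printing Implicit Defensive.
Import Order.TTheory GRing.Theory Num.Theory.
Local Open Scope ring_scope.

(* A graph on the vertex set 'I_n is its set of edges. The type also contains
   sets with members that are not pairs of distinct vertices; the process never
   reaches these. *)
Definition graph (n : nat) := {set {set 'I_n}}.

Definition deg (n : nat) (G : graph n) (v : 'I_n) : nat :=
  #|[set e in G | v \in e]|.

Definition numdeg (n : nat) (G : graph n) (i : nat) : nat :=
  #|[set v : 'I_n | deg G v == i]|.

Definition avail (d n : nat) (G : graph n) : {set {set 'I_n}} :=
  [set e : {set 'I_n} |
    [&& #|e| == 2%N, e \notin G & [forall v in e, (deg G v < d)%N]]].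

(* When [avail d H] is empty the process stops at [H], and all transition
   weights out of [H] are 0. *)
Definition dproc_step (R : realType) (d n : nat) (H G : graph n) : R :=
  \sum_(e in avail d H) (G == e |: H)%:R / #|avail d H|%:R.

(* The probability that the process reaches [s] edges and that its graph at
   that time is [G]; the total mass is therefore the probability that the
   process does not stop before it has [s] edges. *)
Fixpoint dproc_law (R : realType) (d n s : nat) (G : graph n) : R :=
  if s is s'.+1
  then \sum_(H : graph n) dproc_law R d s' H * dproc_step R d H G
  else (G == set0)%:R.

Definition dproc_Pr (R : realType) (d n s : nat) (E : pred (graph n)) : R :=
  \sum_(G : graph n | E G) dproc_law R d s G.

Definition maxedges (d n : nat) : nat := (d * n)./2.

Definition rate (R : realType) (j d t n : nat) : R :=
  2 * ((d - 1) ^_ (d - 1 - j))%:R * t%:R / ln (n%:R : R) ^+ (d - 1 - j).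

(* Main.v *)
Require Import Defs.
From HB Require Import structures.
From mathcomp Require Import all_boot all_order all_algebra.
From mathcomp Require Import ring lra zify.
Set Implicit Arguments.
Unset Strict Implicit.
Unset Printing Implicit Defensive.
Import Order.TTheory GRing.Theory Num.Theory.
Local Open Scope ring_scope.

(** A vertex that is still unsaturated (of degree less than d) is hit by the
    next edge with probability 2/U + O(1/U^2), where U is the number of
    unsaturated vertices. So if a clock advances by 2/U at each step, every
    vertex behaves like a Poisson process of rate one in clock time that is
    stopped at d hits, and distinct vertices are nearly independent. After
    clock time r about n e^{-r} r^i / i! vertices have degree i < d. When 2t
    edge ends are missing, nearly all unsaturated vertices have degree d - 1,
    so that n e^{-r} r^{d-1} / (d-1)! is about 2t; then r is close to log n, and
    the expected number of vertices of degree j is about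
    2t [(d-1)!/j!] / (log n)^{d-1-j}, the parameter of the Poisson law.

    The clock is random, because U is. Instead of following U, fix the final time
    of the clock and predict: let r be the clock time that remains and, for a
    function g of the degree, let [poisson_mean d g x r] be
    the mean of g (x + Z) for Z Poisson of mean r. For a set K of k vertices the
    product of these means over K is a martingale up to a factor
    exp (+- O(1/U^2)) per step, whatever U does ([poisson_mean_prod_step]). The
    error is relative because g is nonincreasing, so a hit only makes a factor
    smaller. As U is at least the number of missing edge ends divided by d,
    the errors of all steps multiply to exp (+- O(1/t)) ([predicted_moment_run]).
    Summing over K gives factorial moments.

    First take g x = (d - x)^+ / d. The sum of g over the vertices is the number
    of missing edge ends divided by d, which is known at every step. Its
    prediction at the start is 2t e^{-eps} / d when the initial clock exceeds
    the ideal value by eps ([start_clock]). The first two moments and Chebyshev's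
    inequality show that the prediction stays there; since with t edges to go
    the true value is 2t / d, the clock has not run out, and at most O(eps)
    is left on it, with high probability ([bad_prob_cvg]).

    Then take for g the indicator of degrees at most j. When O(eps) is left on
    the clock, the product of the predictions over K is up to a factor
    exp (O(k eps)) the indicator that all of K has degree at most j, so the
    factorial moments of the number of these vertices are close to lambda^k
    ([good_moment_close]). For bounded lambda this gives the Poisson law through
    the inclusion-exclusion formula for P(D = i); for large lambda it gives
    concentration, and both sides of the claim are small. The vertices of degree
    less than j have mean o(lambda), which allows passing from degree at most j
    to degree j ([exact_degree_poisson]). *)

(** * Graphs of the process *)

Definition unsat (d n : nat) (G : graph n) : {set 'I_n} :=
  [set v | (deg G v < d)%N].

(** The invariants of the graphs that the process reaches with s edges. *)
Definition legal (d n s : nat) (G : graph n) : Prop :=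
  [/\ forall e, e \in G -> #|e| = 2%N, forall v, (deg G v <= d)%N & #|G| = s].

Lemma deg_add n (G : graph n) e v :
  e \notin G -> deg (e |: G) v = (deg G v + (v \in e))%N.
Proof.
move=> eG; rewrite /deg addnC.
have -> : [set e0 in e |: G | v \in e0] =
          (if v \in e then [set e] else set0 : {set {set 'I_n}}) :|: [set e0 in G | v \in e0].
  apply/setP => f; rewrite !inE; case: ifP => ve; rewrite !inE.
    by case: eqP => [->|] //=; rewrite ve.
  by case: eqP => [->|] //=; rewrite ve (negbTE eG).
case: ifP => ve; last by rewrite set0U.
by rewrite cardsU1 !inE (negbTE eG).
Qed.

Lemma sum_card_incident n (A : {set {set 'I_n}}) :
  (forall e, e \in A -> #|e| = 2%N) ->
  (\sum_(v : 'I_n) #|[set e in A | v \in e]| = 2 * #|A|)%N.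
Proof.
move=> A2.
under eq_bigr => v _ do rewrite -sum1_card.
rewrite (exchange_big_dep (mem A)) /=; last by move=> v e _; rewrite inE => /andP[].
rewrite mulnC -sum_nat_const.
apply: eq_bigr => e eA; rewrite -(A2 e eA) -sum1_card; apply: eq_bigl => v.
by rewrite inE eA.
Qed.

Lemma sum_deg d n s (G : graph n) :
  legal d s G -> (\sum_v deg G v = 2 * s)%N.
Proof. by case=> G2 _ <-; exact: sum_card_incident. Qed.

Lemma sum_deficit d n s (G : graph n) :
  legal d s G -> (\sum_v (d - deg G v) = d * n - 2 * s)%N.
Proof.
move=> lG; rewrite -(sum_deg lG) sumnB; last by case: lG.
by rewrite sum_nat_const card_ord mulnC.
Qed.

(** An unsaturated vertex lacks at most d edge ends, so U is large as long as
    many edges are missing; this is the only lower bound on U in the proof. *)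
Lemma deficit_le_unsat d n s (G : graph n) :
  legal d s G -> (d * n - 2 * s <= d * #|unsat d G|)%N.
Proof.
move=> lG; rewrite -(sum_deficit lG) (bigID (mem (unsat d G))) /=.
rewrite [X in (_ + X)%N]big1; last first.
  by move=> v; rewrite inE -leqNgt => h; apply/eqP; rewrite subn_eq0.
rewrite addn0 mulnC -sum_nat_const; apply: leq_sum => v _; exact: leq_subr.
Qed.

Lemma avail_card2 d n (G : graph n) e : e \in avail d G -> #|e| = 2%N.
Proof. by rewrite inE => /and3P[/eqP]. Qed.

Lemma avail_notin d n (G : graph n) e : e \in avail d G -> e \notin G.
Proof. by rewrite inE => /and3P[]. Qed.

Lemma avail_deg d n (G : graph n) e v :
  e \in avail d G -> v \in e -> (deg G v < d)%N.
Proof. by rewrite inE => /and3P[_ _ /forall_inP/(_ v)]. Qed.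

Lemma legal0 d n : legal d 0 (set0 : graph n).
Proof.
split=> [e|v|]; rewrite ?inE ?cards0 //.
by rewrite /deg (_ : [set _ in _ | _] = set0) ?cards0 //; apply/setP => e; rewrite !inE.
Qed.

Lemma legal_add d n s (G : graph n) e :
  legal d s G -> e \in avail d G -> legal d s.+1 (e |: G).
Proof.
move=> [G2 Gd <-] eA; split=> [f|v|].
- by rewrite !inE => /orP[/eqP ->|/G2 //]; exact: avail_card2 eA.
- rewrite (deg_add _ (avail_notin eA)); case: (boolP (v \in e)) => ve /=.
    by rewrite addn1; exact: avail_deg eA ve.
  by rewrite addn0.
- by rewrite cardsU1 (avail_notin eA).
Qed.

Definition partners (d n : nat) (G : graph n) (v : 'I_n) : nat :=
  #|[set e in avail d G | v \in e]|.

Lemma partners_sat d n (G : graph n) v : v \notin unsat d G -> partners d G v = 0%N.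
Proof.
rewrite inE -leqNgt => h; apply/eqP; rewrite cards_eq0; apply/eqP/setP => e.
rewrite in_set in_set0; apply/negbTE/negP => /andP[eA ve].
by have := avail_deg eA ve; rewrite ltnNge h.
Qed.

Lemma pair_of (n : nat) (e : {set 'I_n}) v : #|e| = 2%N -> v \in e ->
  exists2 w, w != v & e = [set v; w].
Proof.
move=> /eqP/cards2P[x [y] [xy ->]]; rewrite !inE => /orP[]/eqP ->.
  by exists y; rewrite // eq_sym.
by exists x => //; rewrite setUC.
Qed.

Lemma partners_ub d n (G : graph n) v : (partners d G v <= #|unsat d G|)%N.
Proof.
rewrite /partners.
apply: (@leq_trans #|[set [set v; w] | w in unsat d G]|); last exact: leq_imset_card.
apply: subset_leq_card; apply/fintype.subsetP => e; rewrite inE => /andP[eA ve].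
have [w wv ee] := pair_of (avail_card2 eA) ve.
rewrite ee; apply: imset_f; rewrite inE; apply: (avail_deg eA).
by rewrite ee !inE eqxx orbT.
Qed.

Lemma set2_inj (n : nat) (v : 'I_n) (D : {set 'I_n}) : v \notin D ->
  {in D &, injective (fun w => [set v; w])}.
Proof.
move=> vD w w' wD w'D /setP/(_ w); rewrite !inE eqxx orbT => /esym/orP[]/eqP // wv.
by rewrite -wv wD in vD.
Qed.

(** The map w |-> {v, w} is injective on the other unsaturated vertices, and its
    values are available except for the at most d - 1 edges of G at v. *)
Lemma partners_lb d n s (G : graph n) v : legal d s G -> v \in unsat d G ->
  (#|unsat d G| <= partners d G v + d)%N.
Proof.
move=> lG vU; set D := unsat d G :\ v.
have vD : v \notin D by rewrite !inE eqxx.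
have -> : #|unsat d G| = #|D|.+1 by rewrite (cardsD1 v) vU add1n.
have <- := card_in_imset (set2_inj vD).
have : (deg G v < d)%N by move: vU; rewrite inE.
rewrite /deg /partners => hd.
apply: (@leq_trans (#|[set e in avail d G | v \in e]| + #|[set e in G | v \in e]|).+1).
  rewrite ltnS; apply: leq_trans (leq_card_setU _ _).
  apply: subset_leq_card; apply/fintype.subsetP => e /imsetP[w wD ->].
  have ww : w != v by move: wD; rewrite inE in_set1 => /andP[].
  have wU : w \in unsat d G by move: wD; rewrite inE => /andP[].
  rewrite in_setU [X in X || _]in_set [X in _ || X]in_set !set21 !andbT.
  case: (boolP ([set v; w] \in G)) => eG /=; first by rewrite orbT.
  rewrite orbF !in_set eG cards2 [v == w]eq_sym ww /=; apply/forall_inP => x.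
  by rewrite !inE => /orP[]/eqP ->; [move: vU|move: wU]; rewrite inE.
by rewrite -addnS leq_add2l.
Qed.

(** Counting pairs of an available edge and one of its ends: each of the U
    unsaturated vertices is in between U - d and U of them. *)
Lemma avail_bounds d n s (G : graph n) : legal d s G ->
  (#|unsat d G| * (#|unsat d G| - d) <= 2 * #|avail d G|
     <= #|unsat d G| * #|unsat d G|)%N.
Proof.
move=> lG.
rewrite -(sum_card_incident (@avail_card2 d n G)).
rewrite (bigID (mem (unsat d G))) /= [X in (_ + X)%N]big1 ?addn0; last first.
  by move=> v vU; exact: (partners_sat vU).
rewrite -!(sum_nat_const (mem (unsat d G))); apply/andP; split; apply: leq_sum => v vU.
  by rewrite leq_subLR addnC; exact: (partners_lb lG vU).
exact: partners_ub.
Qed.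

(** * Elementary symmetric functions *)

Section ElementarySymmetric.
Variables (R : realFieldType) (n : nat).
Implicit Types (w : 'I_n -> R) (k : nat).

(** Elementary symmetric function of the weights. For the indicator of a set of
    size D it is the binomial coefficient D choose k, so its expectations are the
    factorial moments divided by k!. *)
Definition elsym k w : R :=
  \sum_(K : {set 'I_n} | #|K| == k) \prod_(v in K) w v.

Lemma elsym0 w : elsym 0 w = 1.
Proof.
rewrite /elsym (big_pred1 set0) ?big_set0 // => K; exact: cards_eq0.
Qed.

Lemma elsym_ge0 k w : (forall v, 0 <= w v) -> 0 <= elsym k w.
Proof. by move=> w0; apply: sumr_ge0 => K _; apply: prodr_ge0. Qed.

Lemma elsym_le k w w' : (forall v, 0 <= w v <= w' v) -> elsym k w <= elsym k w'.
Proof. by move=> ww'; apply: ler_sum => K _; apply: ler_prod. Qed.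

Lemma elsymZ k c w : elsym k (fun v => c * w v) = c ^+ k * elsym k w.
Proof.
rewrite /elsym big_distrr; apply: eq_bigr => K /eqP <-.
by rewrite big_split prodr_const.
Qed.

Lemma elsym_const k c : elsym k (fun _ => c) = 'C(n, k)%:R * c ^+ k.
Proof.
rewrite /elsym (eq_bigr (fun=> c ^+ k)); last by move=> K /eqP <-; rewrite prodr_const.
rewrite sumr_const -[in RHS](card_ord n) -card_draws mulr_natl; congr (_ *+ _).
by apply: eq_card => K; rewrite !inE.
Qed.

Lemma elsym_indicator k (S : {set 'I_n}) :
  elsym k (fun v => (v \in S)%:R) = 'C(#|S|, k)%:R.
Proof.
rewrite -cards_draws -sum1_card natr_sum.
rewrite (eq_bigl (fun K : {set 'I_n} => (#|K| == k) && (K \subset S))); last first.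
  by move=> K; rewrite inE andbC.
rewrite big_mkcondr; apply: eq_bigr => K _; case: ifP => [/fintype.subsetP KS|].
  by apply: big1 => v /KS ->.
move/negbT/subsetPn => [v vK vS]; rewrite (bigD1 v) //= (negbTE vS).
by rewrite mul0r.
Qed.

Lemma elsym1 w : elsym 1 w = \sum_v w v.
Proof.
rewrite /elsym (eq_bigl (fun K => K \in [set [set v] | v : 'I_n])); last first.
  move=> K; apply/cards1P/imsetP => [[v ->]|[v _ ->]]; first by exists v.
  by exists v.
rewrite big_imset /=; last by move=> u v _ _; exact: set1_inj.
by apply: eq_bigr => v _; rewrite big_set1.
Qed.

(** Each set of k + 1 vertices arises from k + 1 pairs (K, v) with v outside K. *)
Lemma elsym_extend k w :
  \sum_(K : {set 'I_n} | #|K| == k) \sum_(v | v \notin K) w v * \prod_(u in K) w u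
  = k.+1%:R * elsym k.+1 w.
Proof.
rewrite (exchange_big_dep predT) //=.
transitivity (\sum_v \sum_(K : {set 'I_n} | (#|K| == k.+1) && (v \in K)) \prod_(u in K) w u).
  apply: eq_bigr => v _.
  rewrite [RHS](reindex_onto (fun K => v |: K) (fun K => K :\ v)) /=; last first.
    by move=> K /andP[_ vK]; rewrite setD1K.
  apply: eq_big => [K|K /andP[_ vK]]; last by rewrite big_setU1.
  apply/esym; rewrite setU11 andbT; case: (boolP (v \in K)) => vK /=.
    rewrite andbF; apply/andP => -[_ /eqP/setP/(_ v)].
    by rewrite !inE eqxx vK.
  by rewrite setU1K // eqxx !andbT cardsU1 vK add1n eqSS.
rewrite (exchange_big_dep (fun K : {set 'I_n} => #|K| == k.+1)) /=; last first.
  by move=> v K _ /andP[].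
rewrite /elsym big_distrr; apply: eq_bigr => K /eqP cK /=.
by rewrite -{2}cK mulr_natl -sumr_const; apply: eq_bigl => v; rewrite cK eqxx.
Qed.

Lemma elsym_mul_sum k w :
  elsym k w * elsym 1 w =
  k.+1%:R * elsym k.+1 w +
  \sum_(K : {set 'I_n} | #|K| == k) \sum_(v in K) w v * \prod_(u in K) w u.
Proof.
rewrite -elsym_extend elsym1 -big_split /= big_distrl; apply: eq_bigr => K _ /=.
rewrite mulrC big_distrl addrC (bigID (mem K)) /=; congr (_ + _).
Qed.

Lemma elsym_mul_sum_ge k w : (forall v, 0 <= w v) ->
  k.+1%:R * elsym k.+1 w <= elsym k w * elsym 1 w.
Proof.
move=> w0; rewrite elsym_mul_sum lerDl; apply: sumr_ge0 => K _; apply: sumr_ge0 => v _.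
by rewrite mulr_ge0 // prodr_ge0.
Qed.

(** A moment of order k, weighted by the sum, costs only moments of order k and
    k + 1; this replaces a Cauchy-Schwarz argument when moments are truncated. *)
Lemma elsym_mul_sum_le k w : (forall v, 0 <= w v <= 1) ->
  elsym k w * elsym 1 w <= k.+1%:R * elsym k.+1 w + k%:R * elsym k w.
Proof.
move=> w01; rewrite elsym_mul_sum lerD2l /elsym big_distrr; apply: ler_sum => K /eqP cK /=.
rewrite -big_distrl /=; apply: ler_wpM2r.
  by apply: prodr_ge0 => v _; case/andP: (w01 v).
by rewrite -cK -sumr_const; apply: ler_sum => v _; case/andP: (w01 v).
Qed.

Lemma elsym_le_exp k w : (forall v, 0 <= w v) -> elsym k w <= elsym 1 w ^+ k.
Proof.
move=> w0; elim: k => [|k IH]; first by rewrite elsym0 expr0.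
rewrite exprSr; apply: le_trans (ler_wpM2r (elsym_ge0 1 w0) IH).
apply: le_trans (elsym_mul_sum_ge k w0).
by rewrite ler_peMl ?elsym_ge0 // ler1n.
Qed.

End ElementarySymmetric.

(** * Averages over the next edge *)

Section EdgeAverage.
Variables (R : realFieldType) (d n s : nat) (G : graph n).
Hypothesis lG : legal d s G.
Local Notation U := #|unsat d G|.
Local Notation h := (2 / U%:R : R).
Hypothesis U_gt0 : (0 < U)%N.
Hypothesis U_large : (2 * d <= U)%N.

Let U0 : 0 < U%:R :> R. Proof. by rewrite ltr0n. Qed.
Let U2d : 2 * d%:R <= U%:R :> R. Proof. by rewrite -natrM ler_nat. Qed.

Let avail_bnd : (U%:R : R) * (U%:R - d%:R) <= 2 * #|avail d G|%:R <= (U%:R : R) * U%:R.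
Proof.
have dU : (d <= U)%N by apply: leq_trans U_large; rewrite mulSn leq_addr.
by rewrite -natrB // -!natrM !ler_nat; exact: (avail_bounds lG).
Qed.

Let half : U%:R / 2 <= U%:R - d%:R :> R. Proof. have := U2d; lra. Qed.

Lemma avail_gt0 : 0 < #|avail d G|%:R :> R.
Proof.
have := avail_bnd => /andP[+ _].
have : 0 < U%:R * (U%:R - d%:R) :> R by rewrite mulr_gt0 //; have := half; have := U0; lra.
lra.
Qed.

Lemma inv_avail_le : (#|avail d G|%:R)^-1 <= h ^+ 2 :> R.
Proof.
rewrite -[leLHS]div1r ler_pdivrMr ?avail_gt0 //.
have /andP[a1 _] := avail_bnd.
have hU : h * U%:R = 2 by rewrite divfK ?gt_eqF.
have : h ^+ 2 * (U%:R * (U%:R / 2)) <= h ^+ 2 * (2 * #|avail d G|%:R).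
  rewrite ler_wpM2l ?sqr_ge0 //; apply: le_trans a1.
  by rewrite ler_wpM2l // ltW.
have -> : h ^+ 2 * (U%:R * (U%:R / 2)) = (h * U%:R) ^+ 2 / 2 by ring.
rewrite hU; lra.
Qed.

(** With N between U - d and U partners of v and 2 |avail| between U (U - d) and
    U^2, the quotient N / |avail| lies within d h^2 of h = 2 / U. *)
Lemma hit_probability v : v \in unsat d G ->
  `| (partners d G v)%:R / #|avail d G|%:R - h | <= d%:R * h ^+ 2 :> R.
Proof.
move=> vU; have a0 := avail_gt0; have /andP[a1 a2] := avail_bnd.
have p1 : (partners d G v)%:R <= U%:R :> R by rewrite ler_nat partners_ub.
have p2 : U%:R - d%:R <= (partners d G v)%:R :> R.
  by rewrite lerBlDr -natrD ler_nat; exact: partners_lb lG vU.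
have d0 : 0 <= d%:R :> R by [].
move: (#|avail d G|%:R : R) ((partners d G v)%:R : R) a0 a1 a2 p1 p2 => a p a0 a1 a2 p1 p2.
have hU : h * U%:R = 2 by rewrite divfK ?gt_eqF.
have h0 : 0 < h by rewrite divr_gt0.
have hd : h * d%:R <= 1 by rewrite mulrAC ler_pdivrMr //; have := U2d; lra.
have h2 : h ^+ 2 * U%:R = 2 * h by rewrite expr2 -mulrA hU mulrC.
have ha1 : U%:R - d%:R <= h * a.
  have : h * (U%:R * (U%:R - d%:R)) <= h * (2 * a) by rewrite ler_wpM2l // ltW.
  have -> : h * (U%:R * (U%:R - d%:R)) = 2 * (U%:R - d%:R) by rewrite mulrA hU.
  have := half; have := U0; lra.
have ha2 : h * a <= U%:R.
  have : h * (2 * a) <= h * (U%:R * U%:R) by rewrite ler_wpM2l // ltW.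
  have -> : h * (U%:R * U%:R) = 2 * U%:R by rewrite mulrA hU.
  lra.
have h2a : d%:R <= d%:R * h ^+ 2 * a.
  have : d%:R * 1 <= d%:R * (h * (h * a)).
    rewrite ler_wpM2l //; apply: le_trans (ler_wpM2l (ltW h0) ha1).
    by rewrite mulrBr hU; lra.
  by rewrite expr2 mulr1 !mulrA.
rewrite ler_norml; apply/andP; split.
  rewrite lerBrDr ler_pdivlMr // mulrDl mulNr; lra.
rewrite lerBlDr ler_pdivrMr // mulrDl; lra.
Qed.

Variables (K : {set 'I_n}) (delta : 'I_n -> R).
Hypothesis delta01 : forall v, 0 <= delta v <= 1.
Hypothesis KU : K \subset unsat d G.

Let edge_weight (e : {set 'I_n}) := \prod_(v in K) (1 - delta v * (v \in e)%:R).

Let edge_weight_lin (e : {set 'I_n}) : #|e| = 2%N ->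
  `| edge_weight e - (1 - \sum_(v in K) delta v * (v \in e)%:R) |
    <= (e \subset K)%:R.
Proof.
move=> /eqP/cards2P[u [w [uw ->]]]; rewrite /edge_weight.
set dd := fun v => if v \in K then delta v else 0.
have -> : \prod_(v in K) (1 - delta v * (v \in [set u; w])%:R) = (1 - dd u) * (1 - dd w).
  rewrite big_mkcond (bigID (mem [set u; w])) /= [X in _ * X]big1 ?mulr1; last first.
    by move=> v vn; case: ifP => // _; rewrite (negbTE vn) mulr0 subr0.
  rewrite (eq_bigr (fun v => 1 - dd v)); last first.
    by move=> v vi; rewrite vi mulr1 /dd; case: ifP => //; rewrite subr0.
  by rewrite big_setU1 ?inE //= big_set1.
have -> : \sum_(v in K) delta v * (v \in [set u; w])%:R = dd u + dd w.
  rewrite big_mkcond (bigID (mem [set u; w])) /= [X in _ + X]big1 ?addr0; last first.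
    by move=> v vn; case: ifP => // _; rewrite (negbTE vn) mulr0.
  rewrite (eq_bigr dd); last first.
    by move=> v vi; rewrite vi mulr1 /dd.
  by rewrite big_setU1 ?inE //= big_set1.
have -> : (1 - dd u) * (1 - dd w) - (1 - (dd u + dd w)) = dd u * dd w by ring.
rewrite subUset !sub1set /dd.
have /andP[u0 u1] := delta01 u; have /andP[w0 w1] := delta01 w.
case: ifP => uK; last by rewrite mul0r normr0.
case: ifP => wK; last by rewrite mulr0 normr0.
by rewrite ger0_norm ?mulr_ge0 // mulr_ile1.
Qed.

(** The product over the ends of an edge in K is linear in delta unless the whole
    edge lies in K, and this has probability O(h^2). The linear part is computed
    from the hit probabilities. *)
Lemma edge_average :
  `| (\sum_(e in avail d G) edge_weight e) / #|avail d G|%:R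
      - (1 - h * \sum_(v in K) delta v) |
    <= (#|K| ^ 2 + d * #|K|)%:R * h ^+ 2.
Proof.
have a0 := avail_gt0; set a : R := #|avail d G|%:R in a0 *.
set S := \sum_(e in avail d G) edge_weight e.
pose N v : R := (partners d G v)%:R.
have S1 : `| S - (a - \sum_(v in K) delta v * N v) | <= (#|K| ^ 2)%:R.
  have -> : a - \sum_(v in K) delta v * N v =
      \sum_(e in avail d G) (1 - \sum_(v in K) delta v * (v \in e)%:R).
    rewrite sumrB sumr_const; congr (_ - _).
    rewrite exchange_big /=; apply: eq_bigr => v _.
    rewrite -mulr_sumr; congr (_ * _); rewrite /N /partners -sum1_card natr_sum.
    rewrite [RHS](bigID (fun e : {set 'I_n} => v \in e)) /= [X in _ + X]big1 ?addr0; last first.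
      by move=> e /andP[_ /negbTE ->].
    apply: eq_big => [e|e]; first by rewrite [LHS]in_set.
    by rewrite in_set => /andP[_ ->].
  rewrite -sumrB; apply: le_trans (ler_norm_sum _ _ _) _.
  apply: (@le_trans _ _ (\sum_(e in avail d G) (e \subset K)%:R)).
    by apply: ler_sum => e eA; apply: edge_weight_lin; exact: avail_card2 eA.
  rewrite -natr_sum ler_nat.
  have -> : (\sum_(e in avail d G) (e \subset K) = #|[set e in avail d G | e \subset K]|)%N.
    rewrite -sum1_card [LHS](bigID (fun e : {set 'I_n} => e \subset K)) /= [X in (_ + X)%N]big1 ?addn0; last first.
      by move=> e /andP[_ /negbTE ->].
    apply: eq_big => [e|e]; first by rewrite [RHS]in_set.
    by move=> /andP[_ ->].
  apply: (@leq_trans #|[set e : {set 'I_n} | e \subset K & #|e| == 2%N]|).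
    apply: subset_leq_card; apply/fintype.subsetP => e; rewrite !in_set.
    by move=> /andP[/andP[-> _] ->].
  rewrite cards_draws; apply: leq_trans (leq_bin2l _ _) _; first exact: leqnn.
  by rewrite bin2; nia.
have -> : S / a - (1 - h * \sum_(v in K) delta v) =
  (S - (a - \sum_(v in K) delta v * N v)) / a - \sum_(v in K) delta v * (N v / a - h).
  have -> : \sum_(v in K) delta v * (N v / a - h) =
     (\sum_(v in K) delta v * N v) / a - h * \sum_(v in K) delta v.
    by rewrite mulr_suml mulr_sumr -sumrB; apply: eq_bigr => v _; rewrite mulrBr mulrA [delta v * h]mulrC.
  by field; rewrite gt_eqF //= gt_eqF.
rewrite [(_ ^ 2 + _)%:R]natrD [leRHS]mulrDl.
apply: le_trans (ler_normB _ _) _; apply: lerD.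
  rewrite normrM [`|a^-1|]ger0_norm ?invr_ge0 ?(ltW a0) //.
  by rewrite ler_pM // ?inv_avail_le // invr_ge0 ltW.
apply: le_trans (ler_norm_sum _ _ _) _.
have -> : (d * #|K|)%:R * h ^+ 2 = \sum_(v in K) d%:R * h ^+ 2.
  by rewrite sumr_const natrM -[RHS]mulr_natr mulrAC.
apply: ler_sum => v vK.
have /andP[v0 v1] := delta01 v.
rewrite normrM ger0_norm // -[leRHS]mul1r; apply: ler_pM => //.
by apply: hit_probability; exact: (fintype.subsetP KU).
Qed.

End EdgeAverage.

From mathcomp Require Import all_classical all_reals all_analysis.
Import Order.TTheory GRing.Theory Num.Theory.
Import numFieldNormedType.Exports.
Local Open Scope classical_set_scope.
Local Open Scope ring_scope.

(** * Poisson means of a function of the degree *)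

Section Profiles.
Variables (R : realType) (d : nat).
Implicit Types (g : nat -> R) (r h : R).

(** Monotonicity is what makes errors relative: a hit can only decrease the
    prediction, so that an error in the hit probability is an error in a factor. *)
Definition profile g : Prop :=
  [/\ forall x, 0 <= g x <= 1, forall x, g x.+1 <= g x
    & forall x, (d <= x)%N -> g x = 0].

(** The exponential generating polynomial of g (x + m), that is, the Poisson mean
    without its factor exp (- r). *)
Definition poisson_poly g x r : R := \sum_(m < d) g (x + m)%N * (r ^+ m / m`!%:R).

(** The mean of g (x + Z) for Z Poisson with mean r, when g vanishes from d on:
    the predicted value of g at a vertex of degree x with r left on the clock. *)
Definition poisson_mean g x r : R := expR (- r) * poisson_poly g x r.

Lemma fact_gt0R m : 0 < m`!%:R :> R. Proof. by rewrite ltr0n fact_gt0. Qed.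

Lemma exp_term_ge0 r m : 0 <= r -> 0 <= r ^+ m / m`!%:R.
Proof. by move=> r0; rewrite divr_ge0 ?exprn_ge0 // ltW ?fact_gt0R. Qed.

Lemma exprS_increment_ge r h m : 0 <= r -> 0 <= h ->
  m.+1%:R * h * r ^+ m <= (r + h) ^+ m.+1 - r ^+ m.+1.
Proof.
move=> r0 h0; elim: m => [|m IH]; first by rewrite !expr1 expr0; lra.
have rm0 : 0 <= r ^+ m by rewrite exprn_ge0.
have := ler_wpM2r (addr_ge0 r0 h0) IH.
rewrite mulrBl -[_ ^+ m.+1 * (r + h)]exprSr.
rewrite !(exprS r) -!natr1.
have : 0 <= m%:R * h * h * r ^+ m by rewrite !mulr_ge0.
move: (r ^+ m) rm0 ((r + h) ^+ m.+2) (m%:R : R) => a a0 b M; nra.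
Qed.

Lemma exprS_increment_le r h m : 0 <= r -> 0 <= h ->
  (r + h) ^+ m.+1 - r ^+ m.+1 <= m.+1%:R * h * (r + h) ^+ m.
Proof.
move=> r0 h0; elim: m => [|m IH]; first by rewrite !expr1 expr0; lra.
have le : r ^+ m.+1 <= (r + h) ^+ m.+1 by rewrite lerXn2r ?nnegrE ?addr_ge0 // lerDl.
have := ler_wpM2r (addr_ge0 r0 h0) IH.
have e : forall M : R, M * h * (r + h) ^+ m * (r + h) = M * h * (r + h) ^+ m.+1.
  by move=> M; rewrite exprSr !mulrA.
rewrite e mulrBl -[(r + h) ^+ m.+1 * (r + h)]exprSr mulrDr -exprSr.
rewrite -[m.+2%:R]natr1.
have : h * r ^+ m.+1 <= h * (r + h) ^+ m.+1 by rewrite ler_wpM2l.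
move: (r ^+ m.+1) le => a; move: ((r + h) ^+ m.+1) ((r + h) ^+ m.+2) (m.+1%:R : R) => b c M le; nra.
Qed.

(** The mean value theorem for the monomials r^m / m!. *)
Lemma exp_term_increment r h m : 0 <= r -> 0 <= h ->
  h * (r ^+ m / m`!%:R) <= (r + h) ^+ m.+1 / m.+1`!%:R - r ^+ m.+1 / m.+1`!%:R
    <= h * ((r + h) ^+ m / m`!%:R).
Proof.
move=> r0 h0; rewrite -mulrBl.
have f0 := fact_gt0R m; have S0 : 0 < m.+1%:R :> R by rewrite ltr0n.
have e a : h * (a / m`!%:R) = m.+1%:R * h * a / m.+1`!%:R.
  by rewrite factS natrM; field; rewrite !gt_eqF.
by rewrite !e !ler_pM2r ?invr_gt0 ?fact_gt0R // exprS_increment_ge ?exprS_increment_le.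
Qed.

Lemma exp_partial_sum_le r M : 0 <= r ->
  \sum_(m < M) r ^+ m / m`!%:R <= expR r.
Proof.
move=> r0.
have -> : \sum_(m < M) r ^+ m / m`!%:R = series (exp_coeff r) M.
  by rewrite /series /= big_mkord; apply: eq_bigr => m _; rewrite /exp_coeff.
apply: nondecreasing_cvgn_le; last exact: is_cvg_series_exp_coeff.
apply/nondecreasing_seqP => m; rewrite seriesSr lerDl.
by rewrite /exp_coeff /= exp_term_ge0.
Qed.

Variable g : nat -> R.
Hypothesis gP : profile g.

Let g0 x : 0 <= g x. Proof. by case: gP => /(_ x)/andP[]. Qed.
Let g1 x : g x <= 1. Proof. by case: gP => /(_ x)/andP[]. Qed.
Let gS x : g x.+1 <= g x. Proof. by case: gP. Qed.
Let gd x : (d <= x)%N -> g x = 0. Proof. by case: gP => _ _; apply. Qed.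

Lemma profile_anti x m : g (x + m)%N <= g x.
Proof. by elim: m => [|m IH]; rewrite ?addn0 // addnS (le_trans (gS _)). Qed.

Lemma poisson_poly_ge0 x r : 0 <= r -> 0 <= poisson_poly g x r.
Proof. by move=> r0; apply: sumr_ge0 => m _; rewrite mulr_ge0 ?exp_term_ge0. Qed.

Lemma poisson_poly_ge x r : 0 <= r -> g x <= poisson_poly g x r.
Proof.
move=> r0; rewrite /poisson_poly; case: (leqP d 0) => [|d0].
  by rewrite leqn0 => /eqP d0; rewrite gd ?d0 // -d0 sumr_ge0 // => m _; rewrite mulr_ge0 ?exp_term_ge0.
rewrite (bigD1 (Ordinal d0)) //= addn0 expr0 fact0 divr1 mulr1 lerDl.
by apply: sumr_ge0 => m _; rewrite mulr_ge0 ?exp_term_ge0.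
Qed.

Lemma poisson_poly_le x r : 0 <= r -> poisson_poly g x r <= g x * expR r.
Proof.
move=> r0; apply: (@le_trans _ _ (\sum_(m < d) g x * (r ^+ m / m`!%:R))).
  by apply: ler_sum => m _; rewrite ler_wpM2r ?exp_term_ge0 ?profile_anti.
by rewrite -mulr_sumr ler_wpM2l // exp_partial_sum_le.
Qed.

Lemma poisson_poly_anti x r : 0 <= r -> poisson_poly g x.+1 r <= poisson_poly g x r.
Proof. by move=> r0; apply: ler_sum => m _; rewrite ler_wpM2r ?exp_term_ge0 // addSn. Qed.

Lemma poisson_polyS x r : (0 < d)%N ->
  poisson_poly g x r = g x + \sum_(m < d.-1) g (x + m.+1)%N * (r ^+ m.+1 / m.+1`!%:R).
Proof.
rewrite /poisson_poly; case: d => // d' _; rewrite big_ord_recl /=.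
by rewrite addn0 expr0 fact0 divr1 mulr1.
Qed.

Lemma poisson_poly_next x r : (0 < d)%N ->
  poisson_poly g x.+1 r = \sum_(m < d.-1) g (x + m.+1)%N * (r ^+ m / m`!%:R).
Proof.
have := gd; rewrite /poisson_poly; case: d => // d' gd' _; rewrite big_ord_recr /=.
rewrite [X in _ + X](_ : _ = 0) ?addr0; last first.
  by rewrite gd' ?mul0r // addSn -addnS leq_addl.
by apply: eq_bigr => m _; rewrite addSn addnS.
Qed.

(** The derivative of [poisson_poly d g x] is [poisson_poly d g x.+1], which is
    nondecreasing: these are the bounds of the mean value theorem. *)
Lemma poisson_poly_increment x r h : 0 <= r -> 0 <= h ->
  h * poisson_poly g x.+1 r <= poisson_poly g x (r + h) - poisson_poly g x r <= h * poisson_poly g x.+1 (r + h).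
Proof.
move=> r0 h0; case: (leqP d 0) => [|d0].
  rewrite leqn0 => /eqP d0.
  have q0 y u : poisson_poly g y u = 0 by rewrite /poisson_poly big1 // => m _; case: m; rewrite d0.
  by rewrite !q0 !mulr0 subrr lexx.
rewrite !poisson_poly_next // !(poisson_polyS x) // opprD addrACA subrr add0r -sumrB !mulr_sumr.
apply/andP; split; apply: ler_sum => m _; rewrite -mulrBr mulrCA; apply: ler_wpM2l => //;
  by case/andP: (exp_term_increment m r0 h0).
Qed.

Lemma poisson_mean_ge0 x r : 0 <= r -> 0 <= poisson_mean g x r.
Proof. by move=> r0; rewrite mulr_ge0 ?expR_ge0 ?poisson_poly_ge0. Qed.

Lemma poisson_mean_ge x r : 0 <= r -> expR (- r) * g x <= poisson_mean g x r.
Proof. by move=> r0; rewrite ler_wpM2l ?expR_ge0 ?poisson_poly_ge. Qed.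

Lemma poisson_mean_le x r : 0 <= r -> poisson_mean g x r <= g x.
Proof.
move=> r0; rewrite /poisson_mean expRN mulrC ler_pdivrMr ?expR_gt0 //; exact: poisson_poly_le.
Qed.

Lemma poisson_mean_le1 x r : 0 <= r -> poisson_mean g x r <= 1.
Proof. by move=> r0; apply: le_trans (poisson_mean_le x r0) (g1 x). Qed.

Lemma poisson_mean_anti x r : 0 <= r -> poisson_mean g x.+1 r <= poisson_mean g x r.
Proof. by move=> r0; rewrite ler_wpM2l ?expR_ge0 ?poisson_poly_anti. Qed.

Lemma poisson_mean_sat x r : 0 <= r -> (d <= x)%N -> poisson_mean g x r = 0.
Proof.
move=> r0 dx; apply/eqP; rewrite eq_le poisson_mean_ge0 // andbT.
by apply: le_trans (poisson_mean_le x r0) _; rewrite gd.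
Qed.

(** During the first h units of clock time the Poisson process jumps once with
    probability h + O(h^2), and z is the mean if it jumps once with probability
    exactly h. The upper bound comes from applying the mean value bound twice,
    which leaves a second-order term h^2 [poisson_mean d g x (r + h)], and from
    z being at least half of the mean at r. *)
Lemma poisson_mean_step x r h z : 0 <= r -> 0 <= h <= 1 / 2 ->
  z = poisson_mean g x r - h * (poisson_mean g x r - poisson_mean g x.+1 r) ->
  (1 - h ^+ 2) * z <= poisson_mean g x (r + h) <= (1 + 4 * h ^+ 2) * z.
Proof.
move=> r0 /andP[h0 h12] zE.
have /andP[i1 _] := poisson_poly_increment x r0 h0.
have /andP[_ i2] := poisson_poly_increment x r0 h0.
have /andP[_ i3] := poisson_poly_increment x.+1 r0 h0.
have rh0 : 0 <= r + h by rewrite addr_ge0.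
have a1 := poisson_poly_anti x.+1 rh0; have a0 := poisson_poly_anti x rh0.
have e0 := expR_gt0 (- r).
have -> : poisson_mean g x (r + h) = expR (- h) * (expR (- r) * poisson_poly g x (r + h)).
  by rewrite /poisson_mean opprD expRD mulrA [expR (- h) * _]mulrC.
have x0 := poisson_mean_ge0 x r0; have y0 := poisson_mean_ge0 x.+1 r0.
have xy := poisson_mean_anti x r0.
have q0 := poisson_poly_ge0 x rh0.
set X := poisson_mean g x r in x0 xy zE *; set Y := poisson_mean g x.+1 r in y0 xy zE *.
set T := expR (- r) * poisson_poly g x (r + h).
have T0 : 0 <= T by rewrite mulr_ge0 // ltW.
have T1 : X + h * Y <= T.
  rewrite /X /Y /T /poisson_mean mulrCA -mulrDr ler_wpM2l ?(ltW e0) //; lra.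
have T2 : T <= X + h * Y + h ^+ 2 * T.
  rewrite /X /Y /T /poisson_mean [h * _]mulrCA [h ^+ 2 * _]mulrCA -!mulrDr ler_wpM2l ?(ltW e0) //.
  have : h * poisson_poly g x.+1 (r + h) <= h * (poisson_poly g x.+1 r + h * poisson_poly g x (r + h)).
    rewrite ler_wpM2l //.
    have : h * poisson_poly g x.+2 (r + h) <= h * poisson_poly g x (r + h).
      by rewrite ler_wpM2l // (le_trans a1).
    lra.
  rewrite expr2; lra.
rewrite -/T.
have E1 : 1 - h <= expR (- h) by apply: le_trans (expR_ge1Dx (- h)); lra.
have E2 : expR (- h) * (1 + h) <= 1.
  by rewrite expRN mulrC ler_pdivrMr ?expR_gt0 // mul1r expR_ge1Dx.
move: (expR (- h)) (expR_gt0 (- h)) E1 E2 => E E0 E1 E2; rewrite zE; clearbody X Y T.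
have z0 : X / 2 <= X - h * (X - Y).
  have : h * (X - Y) <= 1 / 2 * X by apply: ler_pM => //; lra.
  lra.
have hh : h ^+ 2 <= 1 / 4.
  have : h * h <= 1 / 2 * (1 / 2) by apply: ler_pM => //; lra.
  rewrite expr2; lra.
apply/andP; split.
  apply: (@le_trans _ _ ((1 - h) * (X + h * Y))).
    have : 0 <= h ^+ 2 * ((X - Y) * (1 - h)) by rewrite mulr_ge0 ?sqr_ge0 // mulr_ge0; lra.
    rewrite expr2; lra.
  have hY : 0 <= h * Y by rewrite mulr_ge0.
  apply: ler_pM; lra.
set Z := X - h * (X - Y) in z0 *.
have Z0 : 0 <= Z by lra.
have s1 : X + h * Y <= Z * (1 + 2 * h ^+ 2) * (1 + h).
  have -> : X + h * Y = Z * (1 + h) + h ^+ 2 * (X - Y) by rewrite /Z; ring.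
  have : h ^+ 2 * (X - Y) <= h ^+ 2 * (2 * Z) by rewrite ler_wpM2l ?sqr_ge0 //; lra.
  have : 0 <= h * (h ^+ 2 * Z) by rewrite !mulr_ge0 ?sqr_ge0.
  lra.
have s2 : E * (X + h * Y) <= Z * (1 + 2 * h ^+ 2).
  have : E * (X + h * Y) <= E * (Z * (1 + 2 * h ^+ 2) * (1 + h)) by rewrite ler_wpM2l // ltW.
  have : Z * (1 + 2 * h ^+ 2) * (E * (1 + h)) <= Z * (1 + 2 * h ^+ 2) * 1.
    by rewrite ler_wpM2l // mulr_ge0 // addr_ge0 // mulr_ge0 // sqr_ge0.
  lra.
have s3 : E * T * (1 - h ^+ 2) <= Z * (1 + 2 * h ^+ 2).
  have : E * (T - h ^+ 2 * T) <= E * (X + h * Y) by rewrite ler_wpM2l ?(ltW E0) //; lra.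
  lra.
have s4 : Z * (1 + 2 * h ^+ 2) <= (1 + 4 * h ^+ 2) * Z * (1 - h ^+ 2).
  have k0 : 0 <= h ^+ 2 by rewrite sqr_ge0.
  move: (h ^+ 2) hh k0 => k hh k0.
  have : 0 <= Z * (k * (1 - 4 * k)) by rewrite !mulr_ge0 //; lra.
  lra.
by rewrite -(ler_pM2r (_ : 0 < 1 - h ^+ 2)) ?(le_trans s3) //; lra.
Qed.

End Profiles.

(** * Prediction over one step of the process *)

Section OneStep.
Variables (R : realType) (d n : nat).

Definition tick (G : graph n) : R := 2 / #|unsat d G|%:R.

Lemma weierstrass_prod (I : Type) (l : seq I) (P : pred I) (w : I -> R) :
  (forall i, P i -> 0 <= w i <= 1) ->
  1 - \sum_(i <- l | P i) w i <= \prod_(i <- l | P i) (1 - w i)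
    <= 1 - \sum_(i <- l | P i) w i + (\sum_(i <- l | P i) w i) ^+ 2.
Proof.
move=> w01; elim: l => [|i l IH]; first by rewrite !big_nil expr0n addr0 subr0 lexx.
rewrite !big_cons; case: (boolP (P i)) => // Pi.
have /andP[i0 i1] := w01 i Pi; move: IH.
have s0 : 0 <= \sum_(j <- l | P j) w j by apply: sumr_ge0 => j /w01/andP[].
move: (\sum_(j <- l | P j) w j) (\prod_(j <- l | P j) _) (w i) i0 i1 s0.
move=> s p x x0 x1 s0 /andP[p1 p2]; apply/andP; split.
  have : (1 - x) * (1 - s) <= (1 - x) * p by rewrite ler_wpM2l // subr_ge0.
  have : 0 <= x * s by rewrite mulr_ge0.
  lra.
have : (1 - x) * p <= (1 - x) * (1 - s + s ^+ 2) by rewrite ler_wpM2l // subr_ge0.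
have : 0 <= x * s by rewrite mulr_ge0.
have : 0 <= x * s ^+ 2 by rewrite mulr_ge0 ?sqr_ge0.
have : 0 <= x ^+ 2 by rewrite sqr_ge0.
rewrite !expr2; lra.
Qed.

(** Turns a factor 1 - y into an exponential, so that errors can be added. *)
Lemma expR_le_half (y : R) : 0 <= y <= 1 / 2 -> expR (- (2 * y)) <= 1 - y.
Proof.
move=> /andP[y0 y1]; rewrite expRN -[leLHS]mul1r ler_pdivrMr ?expR_gt0 //.
apply: (@le_trans _ _ ((1 - y) * (1 + 2 * y))).
  have : 0 <= y * (1 - 2 * y) by rewrite mulr_ge0 //; lra.
  lra.
by rewrite ler_wpM2l ?expR_ge1Dx //; lra.
Qed.

(** The constant C in the one-step error exp (+- C h^2) for k vertices. The first
    term comes from averaging over the edge, the second from replacing a product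
    by a sum, the third from the k Poisson means. *)
Definition step_error (k : nat) : nat := (4 * (k ^ 2 + d * k) + 2 * k ^ 2 + 4 * k)%N.

Variable g : nat -> R.
Hypothesis gP : profile d g.
Variables (s : nat) (G : graph n).
Hypothesis lG : legal d s G.

(** The approximate martingale property. Write the prediction of v after a hit
    as (1 - delta v) times that without a hit. Averaging over the edge gives the
    factor 1 - h sum delta up to O(h^2), and spending h units of clock gives the
    product of the 1 - h delta v up to O(h^2) in each vertex; the two agree to
    first order in h. *)
Lemma poisson_mean_prod_step (K : {set 'I_n}) r : 0 <= r ->
  (4 * (#|K| + d + 1) <= #|unsat d G|)%N ->
  let S := (\sum_(e in avail d G) \prod_(v in K) poisson_mean d g (deg (e |: G) v) r)
             / #|avail d G|%:R in
  let T := \prod_(v in K) poisson_mean d g (deg G v) (r + tick G) in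
  let c := (step_error #|K|)%:R * tick G ^+ 2 in
  expR (- c) * T <= S /\ S <= expR c * T.
Proof.
move=> r0 UK S T c.
have U0 : (0 < #|unsat d G|)%N by lia.
have U2d : (2 * d <= #|unsat d G|)%N by lia.
have UR : 0 < #|unsat d G|%:R :> R by rewrite ltr0n.
have h0 : 0 <= tick G by rewrite divr_ge0.
have U4 : 4 * (#|K|%:R + d%:R + 1) <= #|unsat d G|%:R :> R.
  by rewrite -natrD natr1 -natrM ler_nat; move: UK; rewrite addn1.
have hk : tick G * (#|K|%:R + d%:R + 1) <= 1 / 2.
  rewrite /tick mulrAC ler_pdivrMr //; lra.
have h12 : tick G <= 1 / 2.
  apply: le_trans hk; rewrite -[leLHS]mulr1 ler_wpM2l //.
  by rewrite lerDr.
set h := tick G in h0 hk h12 T c *.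
pose x v := poisson_mean d g (deg G v) r.
pose y v := poisson_mean d g (deg G v).+1 r.
pose z v := x v - h * (x v - y v).
have x0 v : 0 <= x v by apply: poisson_mean_ge0.
have y0 v : 0 <= y v by apply: poisson_mean_ge0.
have yx v : y v <= x v by apply: poisson_mean_anti.
have zstep v := poisson_mean_step gP r0 (introT andP (conj h0 h12)) (erefl (z v)).
(* A vanishing factor stays zero after a hit, so both sides vanish; otherwise
   every vertex of K is unsaturated and delta is a genuine ratio. *)
case: (boolP [exists v in K, x v == 0]) => [/exists_inP[v vK /eqP xv]|].
  have yv : y v = 0 by apply/eqP; rewrite eq_le y0 andbT -xv.
  have zv : z v = 0 by rewrite /z xv yv subrr mulr0 subrr.
  have -> : T = 0.
    rewrite /T (bigD1 v) //= (_ : poisson_mean _ _ _ _ = 0) ?mul0r //.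
    by have := zstep v; rewrite zv !mulr0 -eq_le => /eqP <-.
  have -> : S = 0; last by rewrite !mulr0.
  rewrite /S big1 ?mul0r // => e eA; rewrite (bigD1 v) //= deg_add ?(avail_notin eA) //.
  case: (v \in e); rewrite ?addn1 ?addn0; first by rewrite -/(y v) yv mul0r.
  by rewrite -/(x v) xv mul0r.
rewrite negb_exists_in => /forall_inP xK.
have xp v : v \in K -> 0 < x v by move=> vK; rewrite lt_def xK //=.
have KU : K \subset unsat d G.
  apply/fintype.subsetP => v vK; rewrite inE ltnNge; apply/negP => dv.
  by have := xp v vK; rewrite /x poisson_mean_sat // ltxx.
pose delta v := 1 - y v / x v.
have d01 v : 0 <= delta v <= 1.
  rewrite /delta; case: (eqVneq (x v) 0) => [->|xn0].
    by rewrite invr0 mulr0 subr0 lexx ler01.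
  have xv : 0 < x v by rewrite lt_def xn0 /=.
  by rewrite subr_ge0 ler_pdivrMr // mul1r yx /= lerBlDr lerDl divr_ge0.
have yE v : v \in K -> y v = x v * (1 - delta v).
  by move=> vK; rewrite /delta subKr mulrC divfK // gt_eqF // xp.
pose A := \prod_(v in K) x v.
have A0 : 0 < A by apply: prodr_gt0.
have SE : S = A * ((\sum_(e in avail d G) \prod_(v in K) (1 - delta v * (v \in e)%:R)) / #|avail d G|%:R).
  rewrite mulrA /S; congr (_ / _); rewrite big_distrr /=; apply: eq_bigr => e eA.
  rewrite -big_split /=; apply: eq_bigr => v vK.
  rewrite deg_add ?(avail_notin eA) //; case: (v \in e).
    by rewrite addn1 mulr1 -yE.
  by rewrite addn0 mulr0 subr0 mulr1.
have avg := edge_average lG U0 U2d d01 KU.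
rewrite -/(tick G) -/h in avg.
set Sa := (X in A * X) in SE; rewrite -/Sa in avg.
pose sig := h * \sum_(v in K) delta v.
rewrite -/sig in avg.
pose k := #|K|.
have k0 : 0 <= k%:R :> R by [].
have sig0 : 0 <= sig by rewrite mulr_ge0 // sumr_ge0 // => v _; case/andP: (d01 v).
have sigk : sig <= h * k%:R.
  rewrite ler_wpM2l // /k -sum1_card natr_sum; apply: ler_sum => v _.
  by case/andP: (d01 v).
have hk2 : h * k%:R <= 1 / 2.
  by apply: le_trans hk; rewrite ler_wpM2l // -addrA lerDl.
pose P := \prod_(v in K) (1 - h * delta v).
have /andP[P1 P2] : 1 - sig <= P <= 1 - sig + sig ^+ 2.
  rewrite /sig mulr_sumr; apply: weierstrass_prod => v _.
  have /andP[v0 v1] := d01 v; rewrite mulr_ge0 //= mulr_ile1 //; lra.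
pose q := h ^+ 2.
have q0 : 0 <= q by rewrite sqr_ge0.
have q14 : q <= 1 / 2.
  have : h * h <= 1 / 2 * (1 / 2) by apply: ler_pM.
  rewrite /q expr2; lra.
have sq : sig ^+ 2 <= (k ^ 2)%:R * q.
  by rewrite natrX -exprMn [k%:R * h]mulrC; apply: lerXn2r; rewrite // nnegrE mulr_ge0.
have Tz : (1 - q) ^+ k * (A * P) <= T <= (1 + 4 * q) ^+ k * (A * P).
  have AP : A * P = \prod_(v in K) z v.
    rewrite -big_split; apply: eq_bigr => v vK /=; rewrite /z yE //; ring.
  have e1 a : a ^+ k * (A * P) = \prod_(v in K) (a * z v).
    by rewrite AP big_split /= prodr_const.
  have z0 v : 0 <= z v.
    have : h * (x v - y v) <= 1 / 2 * x v.
      by apply: ler_pM => //; [rewrite subr_ge0|rewrite lerBlDr lerDl].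
    by rewrite /z; have := x0 v; lra.
  rewrite !e1; apply/andP; split; apply: ler_prod => v _; have /andP[s1 s2] := zstep v.
    by rewrite mulr_ge0 //=; lra.
  by rewrite poisson_mean_ge0 // addr_ge0.
move/andP: Tz => [T1 T2].
pose C1 := (k ^ 2 + d * k)%N.
have C1E : C1 = (#|K| ^ 2 + d * #|K|)%N by [].
rewrite -C1E -/q in avg.
have C10 : 0 <= C1%:R * q by rewrite mulr_ge0.
have C1q : C1%:R * q <= 1 / 4.
  have : h * (#|K|%:R + d%:R + 1) * (h * (#|K|%:R + d%:R + 1)) <= 1 / 2 * (1 / 2).
    by apply: ler_pM => //; rewrite mulr_ge0 // addr_ge0.
  move=> hk4; apply: (@le_trans _ _ (h * (#|K|%:R + d%:R + 1) * (h * (#|K|%:R + d%:R + 1)))); last by lra.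
  rewrite (_ : _ * _ * (_ * _) = (k%:R + d%:R + 1) ^+ 2 * q); last by rewrite /q /k; ring.
  rewrite mulrC [leRHS]mulrC ler_wpM2l //.
  rewrite /C1 natrD natrX natrM; have : 0 <= d%:R :> R by []. move: k0; move: (k%:R : R) (d%:R : R) => a b a0 b0.
  have : 0 <= a * b by rewrite mulr_ge0.
  have : 0 <= b * b by rewrite mulr_ge0.
  rewrite !expr2; lra.
move: avg; rewrite ler_norml => /andP[avg1 avg2].
set W := 1 - sig in P1 P2 avg1 avg2.
have W12 : 1 / 2 <= W by rewrite /W; lra.
have P0 : 0 <= P by lra.
have W0 : 0 <= W by lra.
have q1k : expR (- (2 * q)) ^+ k <= (1 - q) ^+ k.
  rewrite lerXn2r ?nnegrE ?expR_ge0 ?expR_le_half //; last by rewrite q0 q14.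
  lra.
have q4k : (1 + 4 * q) ^+ k <= expR (4 * q) ^+ k.
  by rewrite lerXn2r ?nnegrE ?expR_ge0 ?expR_ge1Dx // addr_ge0 // mulr_ge0.
rewrite -!expRM_natr in q1k q4k.
have cE : c = 4 * (C1%:R * q) + 2 * ((k ^ 2)%:R * q) + 4 * q * k%:R.
  by rewrite /c /step_error -/k -/q -/C1 !natrD !natrM; ring.
have kq0 : 0 <= (k ^ 2)%:R * q by rewrite mulr_ge0.
have kq1 : 0 <= q * k%:R by rewrite mulr_ge0.
have AP0 : 0 <= A * P by rewrite mulr_ge0 // ltW.
rewrite SE; split.
  apply: (@le_trans _ _ (expR (- c) * (expR (4 * q * k%:R) * (A * P)))).
    by rewrite ler_wpM2l ?expR_ge0 // (le_trans T2) // ler_wpM2r.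
  apply: (@le_trans _ _ (A * (W - C1%:R * q))); last by rewrite ler_wpM2l ?(ltW A0) //; lra.
  rewrite mulrA -expRD mulrCA ler_wpM2l ?(ltW A0) //.
  have PW : P <= W * expR (2 * ((k ^ 2)%:R * q)).
    apply: (@le_trans _ _ (W * (1 + 2 * ((k ^ 2)%:R * q)))); last by rewrite ler_wpM2l ?expR_ge1Dx.
    have : 1 / 2 * (2 * ((k ^ 2)%:R * q)) <= W * (2 * ((k ^ 2)%:R * q)) by rewrite ler_wpM2r // mulr_ge0.
    lra.
  apply: le_trans (ler_wpM2l (expR_ge0 _) PW) _.
  rewrite mulrCA -expRD (_ : _ + _ = - (2 * (2 * (C1%:R * q)))); last by rewrite cE; ring.
  apply: (@le_trans _ _ (W * (1 - 2 * (C1%:R * q)))).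
    by rewrite ler_wpM2l // expR_le_half //; lra.
  have : 1 / 2 * (2 * (C1%:R * q)) <= W * (2 * (C1%:R * q)) by rewrite ler_wpM2r // mulr_ge0.
  lra.
have E1 : 1 <= expR (2 * q * k%:R) * (1 - q) ^+ k.
  apply: (@le_trans _ _ (expR (2 * q * k%:R) * expR (- (2 * q) * k%:R))).
    by rewrite -expRD mulNr subrr expR0.
  by rewrite ler_wpM2l ?expR_ge0.
have E2 : A * Sa <= expR (2 * (C1%:R * q)) * (A * P).
  rewrite [leRHS]mulrCA ler_wpM2l ?(ltW A0) //.
  apply: (@le_trans _ _ ((1 + 2 * (C1%:R * q)) * W)).
    have : 1 / 2 * (2 * (C1%:R * q)) <= W * (2 * (C1%:R * q)) by rewrite ler_wpM2r // mulr_ge0.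
    lra.
  apply: ler_pM; rewrite ?expR_ge1Dx //; lra.
apply: le_trans E2 _.
apply: (@le_trans _ _ (expR (2 * (C1%:R * q)) * (expR (2 * q * k%:R) * (1 - q) ^+ k * (A * P)))).
  by rewrite ler_wpM2l ?expR_ge0 // ler_peMl.
rewrite -[expR (2 * q * k%:R) * _ * _]mulrA [leLHS]mulrA -expRD.
apply: ler_pM; rewrite ?expR_ge0 // ?ler_expR ?cE; last by lra.
by rewrite mulr_ge0 // exprn_ge0 //; lra.
Qed.

End OneStep.

(** * The process with a clock *)

Section ClockedProcess.
Variables (R : realType) (d n : nat).
Implicit Types (f : graph n -> R -> R) (G : graph n) (r : R).
Local Notation tick := (@tick R d n).

(** The expected value of f after m steps, started from G with r left on the
    clock. A step from G costs [tick G]; a run that cannot pay is frozen, and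
    there f' is evaluated in place of f. Hence f' measures the runs that exhaust
    the clock before the horizon. *)
Fixpoint clocked (m : nat) f f' G r : R :=
  if m is m'.+1 then
    if r < tick G then f' G r
    else (\sum_(e in avail d G) clocked m' f f' (e |: G) (r - tick G)) / #|avail d G|%:R
  else f G r.

Lemma clockedE m f1 f1' f2 f2' G r :
  f1 =2 f2 -> f1' =2 f2' -> clocked m f1 f1' G r = clocked m f2 f2' G r.
Proof.
move=> e e'; elim: m G r => [|m IH] G r /=; first exact: e.
by case: ifP => // _; congr (_ / _); apply: eq_bigr => a _; exact: IH.
Qed.

Lemma clocked_sum (I : Type) (l : seq I) (P : pred I) (c : I -> R) (F F' : I -> graph n -> R -> R) m G r :
  clocked m (fun G r => \sum_(i <- l | P i) c i * F i G r)
            (fun G r => \sum_(i <- l | P i) c i * F' i G r) G r =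
  \sum_(i <- l | P i) c i * clocked m (F i) (F' i) G r.
Proof.
elim: m G r => [//|m IH] G r /=; case: ifP => // _.
under eq_bigr => e _ do rewrite IH.
rewrite exchange_big /= mulr_suml; apply: eq_bigr => i _.
by rewrite -mulr_sumr -mulrA.
Qed.

Lemma clocked_lin m a b f f' g g' G r :
  clocked m (fun G r => a * f G r + b * g G r) (fun G r => a * f' G r + b * g' G r) G r =
  a * clocked m f f' G r + b * clocked m g g' G r.
Proof.
elim: m G r => [//|m IH] G r /=; case: ifP => // _.
by under eq_bigr => e _ do rewrite IH; rewrite big_split /= -!mulr_sumr mulrDl !mulrA.
Qed.

Lemma tick_ge0 G : 0 <= tick G.
Proof. by rewrite divr_ge0. Qed.

(** Comparison is needed only at reachable graphs, where the number of missing
    edge ends is known, and at clock values that can occur. *)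
Lemma clocked_le s m f1 f1' f2 f2' G r : legal d s G -> 0 <= r ->
  (forall G r, legal d (s + m) G -> 0 <= r -> f1 G r <= f2 G r) ->
  (forall s' G r, (s' < s + m)%N -> legal d s' G -> 0 <= r < tick G -> f1' G r <= f2' G r) ->
  clocked m f1 f1' G r <= clocked m f2 f2' G r.
Proof.
elim: m s G r => [|m IH] s G r lG r0 le le' /=; first by apply: le; rewrite ?addn0.
case: ifP => hr; first by apply: (le' s) => //; rewrite ?r0 // addnS ltnS leq_addr.
rewrite ler_wpM2r ?invr_ge0 //; apply: ler_sum => e eA.
apply: (IH s.+1); rewrite ?addSnnS //; first exact: legal_add eA.
by rewrite subr_ge0 leNgt hr.
Qed.

Variable g : nat -> R.
Hypothesis gP : profile d g.

(** For g the indicator of an initial segment of degrees, and nothing left on the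
    clock, this is a factorial moment divided by k!. *)
Definition predicted_moment k G r : R := elsym k (fun v => poisson_mean d g (deg G v) r).

Lemma predicted_moment_ge0 k G r : 0 <= r -> 0 <= predicted_moment k G r.
Proof. by move=> r0; apply: elsym_ge0 => v; exact: poisson_mean_ge0. Qed.

Lemma tick_le s G : legal d s G -> (2 * s < d * n)%N -> tick G <= 2 * d%:R / (d * n - 2 * s)%:R.
Proof.
move=> lG sn; have := deficit_le_unsat lG; set Q := (_ - _)%N => QU.
have Q0 : (0 < Q)%N by rewrite subn_gt0.
have U0 : (0 < #|unsat d G|)%N.
  by rewrite lt0n; apply/eqP => U0; move: QU; rewrite U0 muln0 leqNgt Q0.
rewrite /tick ler_pdivrMr ?ltr0n // -[leLHS]mulr1 -!mulrA ler_wpM2l //.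
by rewrite [leRHS]mulrCA [leRHS]mulrC ler_pdivlMr ?ltr0n // mul1r -natrM ler_nat.
Qed.

Lemma predicted_moment_step s k G r : legal d s G -> tick G <= r ->
  (4 * (k + d + 1) <= #|unsat d G|)%N ->
  let S := (\sum_(e in avail d G) predicted_moment k (e |: G) (r - tick G)) / #|avail d G|%:R in
  let c := (step_error d k)%:R * tick G ^+ 2 in
  expR (- c) * predicted_moment k G r <= S /\ S <= expR c * predicted_moment k G r.
Proof.
move=> lG hr Ub S c.
have SE : S = \sum_(K : {set 'I_n} | #|K| == k)
   (\sum_(e in avail d G) \prod_(v in K) poisson_mean d g (deg (e |: G) v) (r - tick G)) / #|avail d G|%:R.
  by rewrite /S /predicted_moment /elsym exchange_big /= mulr_suml.
have r0 : 0 <= r - tick G by rewrite subr_ge0.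
have st (K : {set 'I_n}) : #|K| == k -> _ := fun cK =>
  poisson_mean_prod_step gP lG r0 (etrans (congr1 (fun k => (4 * (k + d + 1) <= #|unsat d G|)%N) (eqP cK)) Ub).
rewrite SE /predicted_moment /elsym !mulr_sumr; split; apply: ler_sum => K cK;
  have [] := st K cK; rewrite subrK (eqP cK) => s1 s2 //.
Qed.

(** The one-step error is C h^2 with h at most 2 d / Q for Q missing edge ends, and
    1 / Q^2 is at most (1 / (Q - 2) - 1 / Q) / 2; so each step costs
    2 d^2 C (1 / (Q - 2) - 1 / Q), and the sum telescopes. *)
Definition drift_error k : R := (2 * d ^ 2 * step_error d k)%:R.

Lemma inv_square_telescope (q : R) : 0 < q ->
  ((q + 2) ^+ 2)^-1 <= (q^-1 - (q + 2)^-1) / 2.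
Proof.
move=> q0; have q2 : 0 < q + 2 by rewrite addr_gt0.
have -> : (q^-1 - (q + 2)^-1) / 2 = (q * (q + 2))^-1 by field; rewrite !gt_eqF.
by rewrite lef_pV2 ?posrE ?exprn_gt0 ?mulr_gt0 // expr2 ler_wpM2r ?lerDl // ltW.
Qed.

(** The one-step errors telescope as Q = d n - 2 s decreases by 2 at each step,
    and stopping early only shortens the product. The total error is small as
    soon as q, the number of missing edge ends at the horizon, is large. *)
Lemma predicted_moment_run s m q k G r : legal d s G -> 0 <= r ->
  (d * n = q + 2 * m + 2 * s)%N -> (4 * d * (k + d + 1) < q)%N ->
  let c := drift_error k * (q%:R^-1 - (q + 2 * m)%:R^-1) in
  expR (- c) * predicted_moment k G r <= clocked m (predicted_moment k) (predicted_moment k) G r /\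
  clocked m (predicted_moment k) (predicted_moment k) G r <= expR c * predicted_moment k G r.
Proof.
move=> lG r0 dn qb; have q0 : (0 < q)%N by apply: leq_trans qb.
elim: m s G r lG r0 dn => [|m IH] s G r lG r0 dn c.
  by rewrite /c muln0 addn0 subrr mulr0 oppr0 expR0 !mul1r.
have P0 := predicted_moment_ge0 k G r0.
have c0 : 0 <= c.
  rewrite mulr_ge0 // subr_ge0 lef_pV2 ?posrE ?ltr0n ?addn_gt0 ?q0 //.
  by rewrite ler_nat leq_addr.
rewrite /=; case: ifP => hr.
  by split; [rewrite ler_piMl // expR_le1 oppr_le0|rewrite ler_peMl // -[leLHS]expR0 ler_expR].
have {}hr : tick G <= r by rewrite leNgt hr.
have Qs : (d * n - 2 * s = q + 2 * m + 2)%N by lia.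
have Ub : (4 * (k + d + 1) <= #|unsat d G|)%N.
  have := deficit_le_unsat lG; rewrite Qs; nia.
have [st1 st2] := predicted_moment_step lG hr Ub.
set a1 : R := (q + 2 * m)%:R.
have a10 : 0 < a1 by rewrite ltr0n addn_gt0 q0.
have a2E : (q + 2 * m.+1)%:R = a1 + 2 :> R by rewrite /a1 -natrD; congr (_%:R); lia.
pose c1 := drift_error k * (q%:R^-1 - a1^-1).
pose c2 := (step_error d k)%:R * tick G ^+ 2.
have cc : c1 + c2 <= c.
  have tk : tick G <= 2 * d%:R / (a1 + 2).
    apply: le_trans (tick_le lG _) _; first by lia.
    by rewrite Qs natrD.
  have tk2 : tick G ^+ 2 <= 4 * d%:R ^+ 2 * ((a1^-1 - (a1 + 2)^-1) / 2).
    apply: (@le_trans _ _ (4 * d%:R ^+ 2 * ((a1 + 2) ^+ 2)^-1)).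
      have -> : 4 * d%:R ^+ 2 * ((a1 + 2) ^+ 2)^-1 = (2 * d%:R / (a1 + 2)) ^+ 2.
        by field; rewrite gt_eqF // addr_gt0.
      by apply: lerXn2r => //; rewrite nnegrE ?tick_ge0 // divr_ge0 // ltW // addr_gt0.
    by rewrite ler_wpM2l ?inv_square_telescope // mulr_ge0 // sqr_ge0.
  have : (step_error d k)%:R * tick G ^+ 2 <=
     (step_error d k)%:R * (4 * d%:R ^+ 2 * ((a1^-1 - (a1 + 2)^-1) / 2)) by rewrite ler_wpM2l.
  rewrite /c /c1 /c2 a2E /drift_error !natrM; lra.
have IHe e : e \in avail d G -> expR (- c1) * predicted_moment k (e |: G) (r - tick G) <=
   clocked m (predicted_moment k) (predicted_moment k) (e |: G) (r - tick G) /\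
   clocked m (predicted_moment k) (predicted_moment k) (e |: G) (r - tick G) <= expR c1 * predicted_moment k (e |: G) (r - tick G).
  move=> eA; apply: (IH s.+1); [exact: legal_add eA|by rewrite subr_ge0|lia].
split.
  apply: (@le_trans _ _ (expR (- c1) * (expR (- c2) * predicted_moment k G r))).
    by rewrite mulrA -expRD ler_wpM2r // ler_expR; lra.
  apply: (@le_trans _ _ _ _ _ (ler_wpM2l (expR_ge0 _) st1)).
  rewrite mulrA ler_wpM2r ?invr_ge0 // mulr_sumr; apply: ler_sum => e /IHe[] //.
apply: (@le_trans _ _ (expR c1 * (expR c2 * predicted_moment k G r))); last first.
  by rewrite mulrA -expRD ler_wpM2r // ler_expR.
apply: (@le_trans _ _ _ _ _ _ (ler_wpM2l (expR_ge0 _) st2)).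
rewrite mulrA ler_wpM2r ?invr_ge0 // mulr_sumr; apply: ler_sum => e /IHe[] //.
Qed.

End ClockedProcess.

(** * The law of the process as a backward recursion *)

Section LawAsRecursion.
Variables (R : realType) (d n : nat).
Implicit Types (f : graph n -> R) (G : graph n) (r : R).

Fixpoint dvalue (m : nat) f G : R :=
  if m is m'.+1
  then (\sum_(e in avail d G) dvalue m' f (e |: G)) / #|avail d G|%:R
  else f G.

(** Forward and backward recursion agree: shifting one step from the law to the
    function exchanges the sums over the present and the next graph. *)
Lemma dvalue_law s m f :
  \sum_(G : graph n) dproc_law R d s G * dvalue m f G =
  \sum_(G : graph n) dproc_law R d (s + m) G * f G.
Proof.
elim: m s => [|m IH] s; first by rewrite addn0.
rewrite addnS -addSn -IH /=.
under [RHS]eq_bigr => H _ do rewrite mulr_suml.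
rewrite exchange_big /=; apply: eq_bigr => G _.
under [RHS]eq_bigr => H _ do rewrite -mulrA.
rewrite -mulr_sumr; congr (_ * _).
rewrite /dproc_step; under [RHS]eq_bigr => H _ do rewrite mulr_suml.
rewrite exchange_big /= mulr_suml; apply: eq_bigr => e eA.
rewrite (bigD1 (e |: G)) //= eqxx mul1r mulrC big1 ?addr0 // => H /negbTE ->.
by rewrite !mul0r.
Qed.

Lemma dproc_Pr_dvalue s (E : pred (graph n)) :
  dproc_Pr R d s E = dvalue s (fun G => (E G)%:R) finset.set0.
Proof.
transitivity (\sum_(G : graph n) dproc_law R d s G * (E G)%:R).
  rewrite /dproc_Pr big_mkcond; apply: eq_bigr => G _.
  by case: (E G); rewrite ?mulr1 ?mulr0.
rewrite -[in LHS](add0n s) -dvalue_law (bigD1 finset.set0) //= eqxx mul1r big1 ?addr0 // => G /negbTE ->.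
by rewrite mul0r.
Qed.

Lemma dvalue_01 m f G : (forall G, 0 <= f G <= 1) -> 0 <= dvalue m f G <= 1.
Proof.
move=> f01; elim: m G => [//|m IH] G /=; apply/andP; split.
  by rewrite mulr_ge0 ?invr_ge0 // sumr_ge0 // => e _; case/andP: (IH (e |: G)).
case: (posnP #|avail d G|) => [->|a0]; first by rewrite invr0 mulr0.
rewrite ler_pdivrMr ?ltr0n // mul1r -sum1_card natr_sum; apply: ler_sum => e _.
by case/andP: (IH (e |: G)).
Qed.

Lemma clocked_dvalue m f G r : (forall G, 0 <= f G <= 1) ->
  clocked d m (fun G _ => f G) (fun _ _ => 0) G r <= dvalue m f G
    <= clocked d m (fun G _ => f G) (fun _ _ => 1) G r.
Proof.
move=> f01; elim: m G r => [|m IH] G r /=; first by rewrite lexx.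
case: ifP => _; first exact: (dvalue_01 m.+1 G f01).
by rewrite !ler_wpM2r ?invr_ge0 //; apply: ler_sum => e _; case/andP: (IH (e |: G) (r - tick R d G)).
Qed.

(** Runs that are frozen, or that reach the horizon with an unwanted clock value,
    are counted on the right; on all others the two sides agree. *)
Lemma dproc_Pr_clocked m (E : pred (graph n)) r (good : pred R) : 0 <= r ->
  `| dproc_Pr R d m E -
     clocked d m (fun G r => (E G && good r)%:R) (fun _ _ => 0) finset.set0 r |
  <= clocked d m (fun (_ : graph n) r => (~~ good r)%:R) (fun _ _ => 1) finset.set0 r.
Proof.
move=> r0; rewrite dproc_Pr_dvalue.
have E01 (G : graph n) : 0 <= ((E G)%:R : R) <= 1 by case: (E G); rewrite ?lexx ?ler01.
have /andP[l u] := clocked_dvalue m finset.set0 r E01.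
have l2 : clocked d m (fun G r => (E G && good r)%:R) (fun _ _ => 0) finset.set0 r <=
          clocked d m (fun G _ => (E G)%:R) (fun _ _ => 0) (finset.set0 : graph n) r.
  apply: (clocked_le (s := 0)) => // [|G x _ _]; first exact: legal0.
  by rewrite ler_nat; case: (E G) => //; case: (good x).
have u2 : clocked d m (fun G _ => (E G)%:R) (fun _ _ => 1) (finset.set0 : graph n) r <=
   1 * clocked d m (fun G r => (E G && good r)%:R) (fun _ _ => 0) finset.set0 r +
   1 * clocked d m (fun (_ : graph n) r => (~~ good r)%:R) (fun _ _ => 1) finset.set0 r.
  rewrite -clocked_lin.
  apply: (clocked_le (s := 0)) => // [|G x _ _|s' G x _ _ _]; first exact: legal0.
    by rewrite !mul1r -natrD ler_nat; case: (E G); case: (good x).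
  by rewrite !mul1r add0r.
rewrite !mul1r in u2; rewrite ler_norml; apply/andP; split; lra.
Qed.

End LawAsRecursion.

(** * Poisson limits from factorial moments *)

Section BinomialInversion.
Local Open Scope nat_scope.

Lemma mul_bin_sub x i l : 'C(x, i) * 'C(x - i, l) = 'C(x, i + l) * 'C(i + l, i).
Proof.
case: (leqP (i + l) x) => ilx; last first.
  rewrite (@bin_small x (i + l)) // mul0n.
  case: (leqP i x) => ix; last by rewrite bin_small.
  by rewrite (@bin_small (x - i)) ?muln0 // ltn_subLR.
have ix : i <= x by apply: leq_trans ilx; rewrite leq_addr.
have lx : l <= x - i by rewrite leq_subRL.
apply/eqP; rewrite -(eqn_pmul2r (_ : 0 < i`! * (l`! * (x - i - l)`!))) ?muln_gt0 ?fact_gt0 //.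
have e1 := bin_fact ix; have e2 := bin_fact lx; have e3 := bin_fact ilx.
have e4 : 'C(i + l, i) * (i`! * l`!) = (i + l)`!.
  by rewrite -[X in _ * (_ * X`!)](addKn i l) bin_fact // leq_addr.
apply/eqP; transitivity x`!.
  by rewrite -e1 -e2; ring.
by rewrite -e3 -e4 subnDA; ring.
Qed.

End BinomialInversion.

Section PoissonFromMoments.
Variable R : realType.
Implicit Types (p : nat -> R) (lam : R).

Lemma alternating_bin_sum y m :
  \sum_(l < m.+1) (-1) ^+ l * 'C(y.+1, l)%:R = (-1) ^+ m * 'C(y, m)%:R :> R.
Proof.
elim: m => [|m IH]; first by rewrite big_ord1 !bin0.
rewrite big_ord_recr /= IH binS natrD exprS; ring.
Qed.

(** Inclusion-exclusion for the indicator of x = i, cut off after m + 1 terms. The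
    alternating partial sums of binomial coefficients of x - i are themselves
    binomial coefficients, so the error is at most the last term that was kept. *)
Lemma binomial_inversion_error i m x :
  `| (x == i)%:R - \sum_(l < m.+1) (-1) ^+ l * 'C(i + l, i)%:R * 'C(x, i + l)%:R |
    <= 'C(i + m, i)%:R * 'C(x, i + m)%:R :> R.
Proof.
have -> : \sum_(l < m.+1) (-1) ^+ l * 'C(i + l, i)%:R * 'C(x, i + l)%:R =
   'C(x, i)%:R * \sum_(l < m.+1) (-1) ^+ l * 'C(x - i, l)%:R :> R.
  rewrite big_distrr; apply: eq_bigr => l _ /=.
  by rewrite mulrCA -[_ * 'C(x - i, l)%:R]natrM mul_bin_sub natrM -mulrA [X in _ * X]mulrC.
rewrite -natrM [('C(i + m, i) * 'C(x, i + m))%N]mulnC -mul_bin_sub.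
case: (ltngtP x i) => xi.
- by rewrite bin_small // mul0r subr0 normr0.
- rewrite -(subnSK xi) alternating_bin_sum sub0r normrN !normrM normr_sign mul1r.
  by rewrite !normr_nat -natrM ler_nat leq_mul // leq_bin2l.
- rewrite xi binn mul1n subnn mul1r big_ord_recl /= expr0 bin0 mulr1 big1 ?addr0.
    by rewrite subrr normr0.
  by move=> l _; rewrite bin0n mulr0.
Qed.

(** The tail at lam is dominated by the tail at B, which makes the remainder
    uniform on bounded intervals. *)
Lemma exp_remainder (B eta : R) : 0 <= B -> 0 < eta -> exists M0, forall m lam,
  (M0 <= m)%N -> 0 <= lam <= B ->
  `| expR (- lam) - \sum_(l < m) (- lam) ^+ l / l`!%:R | <= eta.
Proof.
move=> B0 eta0.
have cB := is_cvg_series_exp_coeff B.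
have /cvgrPdist_le /(_ eta eta0) [M0 _ HM] : series (exp_coeff B) x @[x --> \oo] --> expR B by [].
exists M0 => m lam Mm /andP[l0 lB].
have SE (y : R) N : \sum_(l < N) y ^+ l / l`!%:R = series (exp_coeff y) N.
  by rewrite /series /= big_mkord; apply: eq_bigr.
rewrite SE.
have near_m m' : (m <= m')%N ->
   `|series (exp_coeff (- lam)) m' - series (exp_coeff (- lam)) m| <= eta.
  move=> mm'.
  have d y : series (exp_coeff y) m' - series (exp_coeff y) m =
     \sum_(m <= l < m') y ^+ l / l`!%:R :> R by rewrite sub_series_geq.
  apply: (@le_trans _ _ (series (exp_coeff B) m' - series (exp_coeff B) m)).
    rewrite !d; apply: le_trans (ler_norm_sum _ _ _) _; apply: ler_sum => l _.
    rewrite normf_div normrX normrN normr_nat (ger0_norm l0).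
    by rewrite ler_wpM2r ?invr_ge0 // lerXn2r ?nnegrE.
  have := HM m Mm; rewrite ler_norml => /andP[_ +]; apply: le_trans.
  by rewrite lerD2r // -SE exp_partial_sum_le.
have cl := is_cvg_series_exp_coeff (- lam).
rewrite ler_norml; apply/andP; split.
  rewrite lerBrDr; apply: limr_ge => //; exists m => // m' /= /near_m.
  by rewrite ler_norml => /andP[+ _]; rewrite lerBrDr addrC.
rewrite lerBlDr; apply: limr_le => //; exists m => // m' /= /near_m.
by rewrite ler_norml => /andP[_ +]; rewrite lerBlDr addrC.
Qed.

Lemma poisson_pmf_le i lam : 0 < lam ->
  expR (- lam) * lam ^+ i / i`!%:R <= i.+1%:R / lam.
Proof.
move=> l0; have := expR_ge1Dxn i (ltW l0).
have f0 : 0 < i`!%:R :> R by rewrite ltr0n fact_gt0.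
have f1 : 0 < i.+1`!%:R :> R by rewrite ltr0n fact_gt0.
move=> e; have {}e : lam ^+ i.+1 / i.+1`!%:R <= expR lam by lra.
rewrite expRN -mulrA ler_pdivrMl ?expR_gt0 //.
rewrite mulrA ler_pdivlMr //; apply: le_trans (ler_wpM2r _ e); last by rewrite ler0n.
rewrite factS natrM exprS; rewrite le_eqVlt; apply/orP; left; apply/eqP; field.
by rewrite gt_eqF //= nat1r pnatr_eq0.
Qed.

(** For p the law of a random variable D, the k-th factorial moment
    k! E (D choose k) is compared with lam^k. The scale (1 + lam)^k keeps the
    condition meaningful both for small and for large lam. *)
Definition near_poisson_moments N p (M : nat) (delta lam : R) : Prop :=
  forall k, (k <= M)%N ->
  `| k`!%:R * \sum_(x < N) p x * 'C(x, k)%:R - lam ^+ k | <= delta * (1 + lam) ^+ k.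

(** Both the mass at i and the Poisson weight are alternating sums of factorial
    moments, up to the last term that is kept. The cut-off is chosen so that this
    term is small for all lam up to B, and then delta so that the finitely many
    moments agree closely enough. *)
Lemma poisson_of_moments (i : nat) (B eta : R) : 0 <= B -> 0 < eta ->
  exists M delta, 0 < delta /\ forall N p lam, 0 <= lam <= B -> (forall x, 0 <= p x) ->
  near_poisson_moments N p M delta lam -> (i < N)%N ->
  `| p i - expR (- lam) * lam ^+ i / i`!%:R | <= eta.
Proof.
move=> B0 eta0.
have f0 k : 0 < k`!%:R :> R by rewrite ltr0n fact_gt0.
pose bi := B ^+ i / i`!%:R.
have bi0 : 0 <= bi by rewrite divr_ge0 ?exprn_ge0 // ltW.
have e1 : 0 < eta / 4 / (1 + bi) by rewrite !divr_gt0 //; lra.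
have [M0 HM0] := exp_remainder B0 e1.
have /cvgrPdist_le /(_ _ e1) [M1 _ HM1] : exp_coeff B n @[n --> \oo] --> (0 : R).
  exact: cvg_series_cvg_0 (is_cvg_series_exp_coeff B).
pose m := maxn M0 M1.
(* Effect on the alternating sum of a unit change of the k-th moment in the
   scale of the hypothesis. *)
pose wt k : R := 'C(k, i)%:R / k`!%:R * (1 + B) ^+ k.
have wt0 k : 0 <= wt k by rewrite mulr_ge0 ?exprn_ge0 ?divr_ge0 //; lra.
pose Wt := \sum_(l < m.+1) wt (i + l)%N + wt (i + m)%N.
have Wt0 : 0 <= Wt by rewrite addr_ge0 // sumr_ge0.
exists (i + m)%N, (eta / 4 / (1 + Wt)); split; first by rewrite !divr_gt0 //; lra.
set delta := eta / 4 / (1 + Wt) => N p lam /andP[l0 lB] p0 mom iN.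
have delta0 : 0 <= delta by rewrite !divr_ge0 //; lra.
pose mk k := \sum_(x < N) p x * 'C(x, k)%:R.
have momk k : (k <= i + m)%N -> 'C(k, i)%:R * `|mk k - lam ^+ k / k`!%:R| <= delta * wt k.
  move=> kM; have := mom k kM; rewrite -/(mk k) => mo.
  have -> : mk k - lam ^+ k / k`!%:R = (k`!%:R * mk k - lam ^+ k) / k`!%:R.
    by rewrite mulrBl mulrAC divff ?gt_eqF // mul1r.
  rewrite normf_div normr_nat.
  have -> : delta * wt k = 'C(k, i)%:R * (delta * (1 + B) ^+ k / k`!%:R) by rewrite /wt; ring.
  rewrite ler_wpM2l // ler_wpM2r ?invr_ge0 //.
  apply: le_trans mo _; rewrite ler_wpM2l // lerXn2r ?nnegrE //; lra.
pose alt (F : nat -> R) := \sum_(l < m.+1) (-1) ^+ l * 'C(i + l, i)%:R * F (i + l)%N.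
have s1 : `|p i - alt mk| <= 'C(i + m, i)%:R * mk (i + m)%N.
  have -> : p i = \sum_(x < N) p x * (x == i :> nat)%:R.
    rewrite (bigD1 (Ordinal iN)) //= eqxx mulr1 big1 ?addr0 // => x xi.
    by rewrite (_ : (x == i :> nat) = false) ?mulr0 //; apply: negbTE; apply: contraNneq xi => e; apply/eqP/val_inj.
  have -> : alt mk = \sum_(x < N) p x * \sum_(l < m.+1) (-1) ^+ l * 'C(i + l, i)%:R * 'C(x, i + l)%:R.
    rewrite /alt /mk; under eq_bigr => l _ do rewrite mulr_sumr.
    rewrite exchange_big; apply: eq_bigr => x _ /=; rewrite mulr_sumr.
    by apply: eq_bigr => l _; rewrite mulrCA.
  rewrite -sumrB; apply: le_trans (ler_norm_sum _ _ _) _.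
  rewrite /mk mulr_sumr; apply: ler_sum => x _.
  rewrite -mulrBr normrM ger0_norm // mulrCA ler_wpM2l //.
  exact: binomial_inversion_error.
have s2 : `|alt mk - alt (fun k => lam ^+ k / k`!%:R)| <= delta * \sum_(l < m.+1) wt (i + l)%N.
  rewrite /alt -sumrB mulr_sumr; apply: le_trans (ler_norm_sum _ _ _) _.
  apply: ler_sum => l _; rewrite -mulrBr !normrM normr_sign mul1r normr_nat.
  by apply: momk; rewrite leq_add2l -ltnS.
have s3 : 'C(i + m, i)%:R * mk (i + m)%N <= delta * wt (i + m)%N + 'C(i + m, i)%:R * (lam ^+ (i + m) / (i + m)`!%:R).
  have := momk _ (leqnn _).
  rewrite -[X in X * `|_|]normr_nat -normrM => /(le_trans (ler_norm _)); lra.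
have binE l : 'C(i + l, i)%:R * (lam ^+ (i + l) / (i + l)`!%:R) = lam ^+ i / i`!%:R * (lam ^+ l / l`!%:R).
  have <- : 'C(i + l, i)%:R * (i`!%:R * l`!%:R) = (i + l)`!%:R :> R.
    by rewrite -!natrM -[X in (_ * (_ * X`!))%N](addKn i l) bin_fact // leq_addr.
  rewrite exprD; field; rewrite !gt_eqF //= ltr0n bin_gt0 leq_addr //.
have li : lam ^+ i / i`!%:R <= bi by rewrite /bi ler_wpM2r ?invr_ge0 // lerXn2r ?nnegrE.
have li0 : 0 <= lam ^+ i / i`!%:R by rewrite divr_ge0 ?exprn_ge0.
have s4 : 'C(i + m, i)%:R * (lam ^+ (i + m) / (i + m)`!%:R) <= eta / 4.
  rewrite binE.
  apply: (@le_trans _ _ (bi * (eta / 4 / (1 + bi)))).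
    apply: ler_pM => //; first by rewrite divr_ge0 ?exprn_ge0.
    apply: (@le_trans _ _ (B ^+ m / m`!%:R)); first by rewrite ler_wpM2r ?invr_ge0 // lerXn2r ?nnegrE.
    have := HM1 m (leq_maxr _ _); rewrite sub0r normrN ger0_norm //.
    by rewrite divr_ge0 ?exprn_ge0.
  rewrite mulrA ler_pdivrMr; lra.
have s5 : `|alt (fun k => lam ^+ k / k`!%:R) - expR (- lam) * lam ^+ i / i`!%:R| <= eta / 4.
  have -> : alt (fun k => lam ^+ k / k`!%:R) = lam ^+ i / i`!%:R * \sum_(l < m.+1) (- lam) ^+ l / l`!%:R.
    rewrite /alt mulr_sumr; apply: eq_bigr => l _.
    by rewrite -[LHS]mulrA binE [(- lam) ^+ l]exprNn; ring.
  have -> : expR (- lam) * lam ^+ i / i`!%:R = lam ^+ i / i`!%:R * expR (- lam) by ring.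
  rewrite -mulrBr normrM (ger0_norm li0).
  apply: (@le_trans _ _ (bi * (eta / 4 / (1 + bi)))).
    apply: ler_pM => //; rewrite distrC; apply: HM0; last by rewrite l0 lB.
    by rewrite leqW // leq_maxl.
  rewrite mulrA ler_pdivrMr; lra.
have s6 : delta * Wt <= eta / 4.
  rewrite /delta mulrAC ler_pdivrMr; lra.
have s7 : p i - expR (- lam) * lam ^+ i / i`!%:R = (p i - alt mk) +
  ((alt mk - alt (fun k => lam ^+ k / k`!%:R)) + (alt (fun k => lam ^+ k / k`!%:R) - expR (- lam) * lam ^+ i / i`!%:R)) by ring.
rewrite s7; apply: le_trans (ler_normD _ _) _; apply: le_trans (lerD (lexx _) (ler_normD _ _)) _.
move: s6; rewrite /Wt mulrDr; lra.
Qed.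

(** Chebyshev: the first two factorial moments bound the second moment of D - lam
    by lam + O(delta lam^2). *)
Lemma lower_tail_of_moments N p (delta lam : R) : 0 <= delta -> 1 <= lam ->
  (forall x, 0 <= p x) -> near_poisson_moments N p 2 delta lam ->
  \sum_(x < N | x%:R <= lam / 2) p x <= 4 / lam + 80 * delta.
Proof.
move=> d0 l1 p0 mom.
have := mom 2%N isT; have := mom 1%N isT; have := mom 0%N isT.
rewrite (_ : 0`! = 1%N) // (_ : 1`! = 1%N) // (_ : 2`! = 2%N) // !mul1r !expr0 !mulr1 !expr1.
set m0 := \sum_(x < N) _; set m1 := \sum_(x < N) _; set m2 := \sum_(x < N) _.
rewrite !ler_norml => /andP[_ a0] /andP[a1 _] /andP[_ a2].
have /andP[_ a1'] : - (delta * (1 + lam)) <= m1 - lam <= delta * (1 + lam).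
  by have := mom 1%N isT; rewrite (_ : 1`! = 1%N) // mul1r !expr1 ler_norml.
have var : \sum_(x < N) p x * (x%:R - lam) ^+ 2 = 2 * m2 + m1 - 2 * lam * m1 + lam ^+ 2 * m0.
  rewrite /m0 /m1 /m2 !mulr_sumr -!big_split /= -sumrB -big_split /=; apply: eq_bigr => x _.
  rewrite bin0 bin1.
  have -> : 'C(x, 2)%:R = (x%:R ^+ 2 - x%:R) / 2 :> R.
    have : (2 * 'C(x, 2) + x = x * x)%N.
      have := mul_bin_left x 1; rewrite bin1; nia.
    move/(congr1 (fun y => y%:R : R)); rewrite natrD !natrM expr2 => <-; lra.
  rewrite !expr2; lra.
have : lam ^+ 2 / 4 * \sum_(x < N | x%:R <= lam / 2) p x <= \sum_(x < N) p x * (x%:R - lam) ^+ 2.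
  rewrite mulr_sumr [leLHS]big_mkcond; apply: ler_sum => x _; case: ifP => xl.
    rewrite mulrC ler_wpM2l //.
    have : (lam / 2) ^+ 2 <= (lam - x%:R) ^+ 2.
      by rewrite lerXn2r ?nnegrE //; lra.
    rewrite !expr2; lra.
  by rewrite mulr_ge0 ?sqr_ge0.
rewrite var; set S := \sum_(x < N | _) _ => le.
have l2 : 0 < lam ^+ 2 by rewrite exprn_gt0; lra.
have le2 : lam ^+ 2 / 4 * S <= lam + 20 * delta * lam ^+ 2.
  apply: le_trans le _.
  have la1 : lam * (lam - delta * (1 + lam)) <= lam * m1 by rewrite ler_wpM2l; lra.
  have la0 : lam ^+ 2 * m0 <= lam ^+ 2 * (1 + delta) by rewrite ler_wpM2l; lra.
  have dl : delta <= delta * lam by rewrite ler_peMr.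
  have dl2 : delta * lam <= delta * lam * lam by rewrite ler_peMr // mulr_ge0; lra.
  rewrite !expr2 in a2 la0 *; lra.
rewrite -(ler_pM2l (_ : 0 < lam ^+ 2 / 4)); last by rewrite divr_gt0.
apply: le_trans le2 _; rewrite mulrDr le_eqVlt; apply/orP; left; apply/eqP.
by field; rewrite gt_eqF; lra.
Qed.

End PoissonFromMoments.

(** * Missing edge ends and vertices of small degree *)

Section ConcreteProfiles.
Variables (R : realType) (d n : nat).
Hypothesis d_gt0 : (0 < d)%N.

(** Summed over the vertices this is the number of missing edge ends divided by d,
    a function of the number of steps alone. The division by d makes it a
    profile. *)
Definition deficit (x : nat) : R := (d - x)%:R / d%:R.
Definition below (a x : nat) : R := (x < a)%N%:R.

Let dR : 0 < d%:R :> R. Proof. by rewrite ltr0n. Qed.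

Lemma deficit_profile : profile d deficit.
Proof.
split=> [x|x|x dx]; rewrite /deficit.
- by rewrite divr_ge0 //= ler_pdivrMr // mul1r ler_nat leq_subr.
- by rewrite ler_wpM2r ?invr_ge0 // ler_nat leq_sub2l.
- by rewrite (eqP (_ : d - x == 0)%N) ?mul0r // subn_eq0.
Qed.

Lemma below_profile a : (a <= d)%N -> profile d (below a).
Proof.
move=> ad; split=> [x|x|x dx]; rewrite /below.
- by case: (x < a)%N; rewrite lexx ler01.
- by rewrite ler_nat; case: (ltnP x.+1 a) => // /ltnW ->.
- by rewrite ltnNge (leq_trans ad dx).
Qed.

(** Bernoulli's inequality bounds d - x - m by (d - x) (1 - 1/d)^m, and the mean
    of (1 - 1/d)^Z for Z Poisson with mean r is exp (- r / d). *)
Lemma deficit_decay x r : 0 <= r -> poisson_mean d deficit x r <= expR (- (r / d%:R)) * deficit x.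
Proof.
move=> r0; pose b : R := 1 - d%:R^-1.
have b0 : 0 <= b by rewrite subr_ge0 invf_le1 // ler1n.
have term m : deficit (x + m)%N <= deficit x * b ^+ m.
  rewrite /deficit subnDA mulrAC ler_wpM2r ?invr_ge0 //.
  have : (d - x <= d)%N by exact: leq_subr.
  move: (d - x)%N => y yd; elim: m => [|m IH]; first by rewrite subn0 mulr1.
  rewrite exprSr mulrA; apply: le_trans (ler_wpM2r b0 IH).
  rewrite subnS; case: (posnP (y - m)%N) => [->|ym]; first by rewrite mul0r.
  rewrite -subn1 natrB // /b mulrBr mulr1 lerD2l lerN2 ler_pdivrMr // mul1r ler_nat.
  exact: leq_trans (leq_subr _ _) yd.
have pb : poisson_poly d deficit x r <= deficit x * expR (b * r).
  apply: (@le_trans _ _ (\sum_(m < d) deficit x * ((b * r) ^+ m / m`!%:R))).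
    apply: ler_sum => m _.
    have -> : deficit x * ((b * r) ^+ m / m`!%:R) = deficit x * b ^+ m * (r ^+ m / m`!%:R).
      by rewrite exprMn !mulrA.
    by rewrite ler_wpM2r ?exp_term_ge0.
  rewrite -mulr_sumr; apply: ler_wpM2l; first exact: divr_ge0.
  by apply: exp_partial_sum_le; exact: mulr_ge0.
rewrite /poisson_mean; apply: le_trans (ler_wpM2l (expR_ge0 _) pb) _.
rewrite mulrCA -expRD mulrC le_eqVlt; apply/orP; left; apply/eqP; congr (expR _ * _).
by rewrite /b; field; rewrite gt_eqF.
Qed.

Lemma predicted_moment1 (g : nat -> R) (G : graph n) r : predicted_moment d g 1 G r = \sum_v poisson_mean d g (deg G v) r :> R.
Proof. exact: elsym1. Qed.

Lemma sum_deficit_profile s (G : graph n) : legal d s G ->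
  \sum_v deficit (deg G v) = (d * n - 2 * s)%:R / d%:R.
Proof.
by move=> lG; rewrite /deficit -mulr_suml -(sum_deficit lG) natr_sum.
Qed.

Lemma deficit_moment_ge s (G : graph n) r : legal d s G -> 0 <= r ->
  expR (- r) * ((d * n - 2 * s)%:R / d%:R) <= predicted_moment d deficit 1 G r.
Proof.
move=> lG r0; rewrite predicted_moment1 -(sum_deficit_profile lG) mulr_sumr; apply: ler_sum => v _.
exact: (poisson_mean_ge deficit_profile).
Qed.

Lemma deficit_moment_le s (G : graph n) r : legal d s G -> 0 <= r ->
  predicted_moment d deficit 1 G r <= expR (- (r / d%:R)) * ((d * n - 2 * s)%:R / d%:R).
Proof.
move=> lG r0; rewrite predicted_moment1 -(sum_deficit_profile lG) mulr_sumr; apply: ler_sum => v _.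
exact: deficit_decay.
Qed.

Lemma below_elsym a k (G : graph n) :
  elsym k (fun v => below a (deg G v)) = 'C(#|unsat a G|, k)%:R.
Proof.
rewrite -(elsym_indicator R k (unsat a G)); apply: eq_bigr => K _; apply: eq_bigr => v _.
by rewrite inE.
Qed.

Lemma below_moment_le a k (G : graph n) r : (a <= d)%N -> 0 <= r ->
  predicted_moment d (below a) k G r <= 'C(#|unsat a G|, k)%:R.
Proof.
move=> ad r0; rewrite -below_elsym; apply: elsym_le => v.
by rewrite poisson_mean_ge0 ?poisson_mean_le //; exact: below_profile.
Qed.

(** A vertex is not hit at all for time r with probability exp (- r). *)
Lemma below_moment_ge a k (G : graph n) r : (a <= d)%N -> 0 <= r ->
  expR (- r) ^+ k * 'C(#|unsat a G|, k)%:R <= predicted_moment d (below a) k G r.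
Proof.
move=> ad r0; rewrite -below_elsym -elsymZ; apply: elsym_le => v.
rewrite poisson_mean_ge ?mulr_ge0 ?expR_ge0 //=.
exact: below_profile.
Qed.

Lemma card_unsatS a (G : graph n) : #|unsat a.+1 G| = (#|unsat a G| + numdeg G a)%N.
Proof.
rewrite /numdeg -cardsUI [X in (_ + X)%N](_ : _ = 0%N) ?addn0; last first.
  apply/eqP; rewrite cards_eq0; apply/eqP/setP => v; rewrite !inE.
  by case: ltngtP.
by congr #|pred_of_set _|; apply/setP => v; rewrite !inE ltnS leq_eqVlt orbC.
Qed.

Lemma predicted_moment_init (g : nat -> R) k r :
  predicted_moment d g k (finset.set0 : graph n) r = 'C(n, k)%:R * poisson_mean d g 0 r ^+ k :> R.
Proof.
rewrite -elsym_const /predicted_moment; apply: eq_bigr => K _; apply: eq_bigr => v _.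
congr (poisson_mean _ _ _ _); apply/eqP; rewrite cards_eq0; apply/eqP/setP => e.
by rewrite !inE.
Qed.

End ConcreteProfiles.

(** * Events and truncated moments at the horizon *)

Section Events.
Variables (R : realType) (d n m : nat) (r0 : R).
Hypothesis d_gt0 : (0 < d)%N.
Hypothesis r0_ge0 : 0 <= r0.
Local Notation init := (finset.set0 : graph n).
Local Notation Clk f f' := (clocked d m f f' init r0).

Definition expected_moment g k : R := Clk (predicted_moment d g k) (predicted_moment d g k).

(** The probability that the clock runs out before the horizon, or that more than
    kappa is left on it there. *)
Definition bad_prob (kappa : R) : R :=
  Clk (fun (_ : graph n) (r : R) => (~~ (r <= kappa)%R)%:R) (fun _ _ => 1).
Definition good_moment (kappa : R) a k : R :=
  Clk (fun (G : graph n) (r : R) => 'C(#|unsat a G|, k)%:R * (r <= kappa)%R%:R) (fun _ _ => 0).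
Definition good_mass (kappa : R) a x : R :=
  Clk (fun (G : graph n) (r : R) => ((#|unsat a G| == x) && (r <= kappa)%R)%:R) (fun _ _ => 0).

Lemma run_le f1 f1' f2 f2' :
  (forall (G : graph n) r, legal d m G -> 0 <= r -> f1 G r <= f2 G r) ->
  (forall s (G : graph n) r, (s < m)%N -> legal d s G -> 0 <= r < tick R d G -> f1' G r <= f2' G r) ->
  Clk f1 f1' <= Clk f2 f2'.
Proof. by move=> h h'; apply: (clocked_le (s := 0)) => //; exact: legal0. Qed.

Lemma run_ge0 f f' :
  (forall (G : graph n) r, legal d m G -> 0 <= r -> 0 <= f G r) ->
  (forall s (G : graph n) r, (s < m)%N -> legal d s G -> 0 <= r < tick R d G -> 0 <= f' G r) ->
  0 <= Clk f f'.
Proof.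
move=> h h'; have := clocked_lin d m 0 0 (fun _ _ => 0) (fun _ _ => 0) (fun _ _ => 0) (fun _ _ => 0) init r0.
rewrite !mul0r addr0 => <-; apply: run_le => [G r lG rr|s G r sm lG rr]; rewrite ?mul0r ?addr0.
  exact: h.
exact: (h' s).
Qed.

Lemma bad_prob_ge0 kappa : 0 <= bad_prob kappa.
Proof. by apply: run_ge0. Qed.

Lemma good_mass_ge0 kappa a x : 0 <= good_mass kappa a x.
Proof. by apply: run_ge0. Qed.

(** Chebyshev's inequality. On a bad run the predicted deficit is far from mu, and
    its second moment is expressed by the predicted moments of order 1 and 2, as
    the deficit of one vertex is at most 1. *)
Lemma bad_prob_le kappa (mu c : R) : 0 < c ->
  (forall s (G : graph n) r, (s < m)%N -> legal d s G -> 0 <= r < tick R d G ->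
     c <= predicted_moment d (deficit R d) 1 G r - mu) ->
  (forall (G : graph n) r, legal d m G -> 0 <= r -> kappa < r ->
     c <= mu - predicted_moment d (deficit R d) 1 G r) ->
  bad_prob kappa <=
    (2 * expected_moment (deficit R d) 2 + expected_moment (deficit R d) 1
      - 2 * mu * expected_moment (deficit R d) 1 + mu ^+ 2 * expected_moment (deficit R d) 0) / c ^+ 2.
Proof.
move=> c0 early late; set I := expected_moment (deficit R d); have c2 : 0 < c ^+ 2 by rewrite exprn_gt0.
pose Phi k := @predicted_moment R d n (deficit R d) k.
have sq (G : graph n) r : 0 <= r -> (Phi 1%N G r - mu) ^+ 2 <=
   1 * (2 * Phi 2%N G r + (1 - 2 * mu) * Phi 1%N G r) + mu ^+ 2 * Phi 0%N G r.
  move=> r00; have -> : Phi 0%N G r = 1 by exact: elsym0.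
  rewrite /Phi.
  have := @elsym_mul_sum_le R n 1 (fun v => poisson_mean d (deficit R d) (deg G v) r).
  have P := deficit_profile R d_gt0.
  rewrite -!/(predicted_moment d _ _ G r) => /(_ (fun v => introT andP (conj (poisson_mean_ge0 P _ r00) (poisson_mean_le1 P _ r00)))).
  rewrite !expr2; lra.
rewrite ler_pdivlMr // mulrC.
have -> : 2 * I 2%N + I 1%N - 2 * mu * I 1%N + mu ^+ 2 * I 0%N =
   1 * (2 * I 2%N + (1 - 2 * mu) * I 1%N) + mu ^+ 2 * I 0%N by ring.
rewrite /I /expected_moment -!clocked_lin.
have -> : c ^+ 2 * bad_prob kappa = c ^+ 2 * bad_prob kappa + 0 * bad_prob kappa by ring.
rewrite /bad_prob -clocked_lin; apply: run_le => [G r lG r00|s G r sm lG /andP[r00 rt]].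
  rewrite mul0r addr0; case: (lerP r kappa) => kr /=; rewrite ?mulr0 ?mulr1; apply: le_trans (sq G r r00).
    exact: sqr_ge0.
  have := late G r lG r00 kr => le; rewrite -[leRHS]sqrrN opprB lerXn2r ?nnegrE // /Phi; lra.
rewrite mul0r addr0 mulr1; apply: le_trans (sq G r r00).
have := early s G r sm lG (introT andP (conj r00 rt)) => le; rewrite lerXn2r ?nnegrE // /Phi; lra.
Qed.

Lemma good_moment_ge0 kappa a k : 0 <= good_moment kappa a k.
Proof. by apply: run_ge0 => // G r _ _; rewrite mulr_ge0. Qed.

Lemma good_moment_le kappa a k : (a <= d)%N ->
  good_moment kappa a k <= expR (kappa * k%:R) * expected_moment (below R a) k.
Proof.
move=> ad.
have -> : expR (kappa * k%:R) * expected_moment (below R a) k =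
  expR (kappa * k%:R) * expected_moment (below R a) k + 0 * expected_moment (below R a) k by rewrite mul0r addr0.
rewrite -clocked_lin; apply: run_le => [G r lG r00|s G r sm lG /andP[r00 rt]]; rewrite mul0r addr0.
  have P0 := predicted_moment_ge0 (below_profile R ad) k G r00.
  case: (lerP r kappa) => kr /=; rewrite ?mulr0 ?mulr1; last by rewrite mulr_ge0 ?expR_ge0.
  have := below_moment_ge k G ad r00.
  rewrite expRN exprVn mulrC ler_pdivrMr ?exprn_gt0 ?expR_gt0 // mulrC => /le_trans; apply.
  by rewrite ler_wpM2r // -expRM_natr ler_expR ler_wpM2r.
by rewrite mulr_ge0 ?expR_ge0 // predicted_moment_ge0 //; exact: below_profile.
Qed.

(** Bad runs contribute at most B^k each where the predicted count is below B;
    where it exceeds B, they are dominated by a moment of higher order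
    divided by B. *)
Lemma expected_moment_le kappa a k (B : R) : (a <= d)%N -> 0 < B ->
  expected_moment (below R a) k <= good_moment kappa a k +
    ((k.+1%:R * expected_moment (below R a) k.+1 + k%:R * expected_moment (below R a) k) / B
     + B ^+ k * bad_prob kappa).
Proof.
move=> ad B0; have P := below_profile R ad.
set I := expected_moment (below R a).
have -> : good_moment kappa a k + ((k.+1%:R * I k.+1 + k%:R * I k) / B + B ^+ k * bad_prob kappa) =
  1 * good_moment kappa a k + 1 * (1 * (k.+1%:R / B * I k.+1 + k%:R / B * I k) + B ^+ k * bad_prob kappa).
  by rewrite !mul1r; congr (_ + (_ + _)); rewrite mulrDl; congr (_ + _); rewrite mulrAC.
rewrite /I /expected_moment /good_moment /bad_prob -!clocked_lin.
have key (G : graph n) r : 0 <= r -> predicted_moment d (below R a) k G r <=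
   (k.+1%:R / B * predicted_moment d (below R a) k.+1 G r + k%:R / B * predicted_moment d (below R a) k G r) + B ^+ k.
  move=> r00.
  have w0 v := poisson_mean_ge0 P (deg G v) r00.
  have w1 v := poisson_mean_le1 P (deg G v) r00.
  have m1 := elsym_mul_sum_le k (fun v => introT andP (conj (w0 v) (w1 v))).
  have m2 := elsym_le_exp k w0.
  rewrite -!/(predicted_moment d _ _ G r) in m1 m2.
  have p0 i := predicted_moment_ge0 P i G r00.
  rewrite [_ / B * _]mulrAC [k%:R / B * _]mulrAC -mulrDl.
  case: (lerP (predicted_moment d (below R a) 1 G r) B) => hB.
    apply: le_trans m2 _; apply: (@le_trans _ _ (B ^+ k)); first by rewrite lerXn2r ?nnegrE // ltW.
    by rewrite lerDr divr_ge0 ?(ltW B0) // addr_ge0 // mulr_ge0.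
  apply: (@le_trans _ _ ((k.+1%:R * predicted_moment d (below R a) k.+1 G r + k%:R * predicted_moment d (below R a) k G r) / B)).
    rewrite ler_pdivlMr //; apply: le_trans m1; rewrite ler_wpM2l //; exact: ltW.
  by rewrite lerDl exprn_ge0 // ltW.
apply: run_le => [G r lG r00|s G r sm lG /andP[r00 rt]]; rewrite !mul1r; last first.
  by rewrite add0r mulr1; exact: key.
have p0 i := predicted_moment_ge0 P i G r00.
case: (lerP r kappa) => kr /=; rewrite ?mulr1 ?mulr0 ?addr0 ?add0r; last exact: key.
apply: le_trans (below_moment_le k G ad r00) _; rewrite lerDl.
by rewrite addr_ge0 // mulr_ge0 // divr_ge0 // ltW.
Qed.

Lemma good_massE kappa a k :
  \sum_(x < n.+1) good_mass kappa a x * 'C(x, k)%:R = good_moment kappa a k.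
Proof.
rewrite /good_mass; under eq_bigr => x _ do rewrite mulrC.
rewrite -(clocked_sum d (index_enum 'I_n.+1) predT (fun x : 'I_n.+1 => 'C(x, k)%:R)
  (fun x G r => ((#|unsat a G| == x) && (r <= kappa)%R)%:R) (fun _ _ _ => 0)).
apply: clockedE => G r; last by rewrite big1 // => x _; rewrite mulr0.
have xn : (#|unsat a G| < n.+1)%N by rewrite ltnS -[leqRHS]card_ord max_card.
rewrite (bigD1 (Ordinal xn)) //= eqxx /= big1 ?addr0 // => x xG.
by rewrite (_ : (_ == _ :> nat) = false) ?mulr0 //; apply: negbTE; apply: contraNneq xG => e; apply/eqP/val_inj.
Qed.

End Events.

(** * Limits of real sequences *)

Section Scales.
Variable R : realType.
Implicit Types u v : nat -> R.

Lemma cvg_near_eq u v (a : R) : (\forall n \near \oo, u n = v n) ->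
  v n @[n --> \oo] --> a -> u n @[n --> \oo] --> a.
Proof.
move=> e; apply: cvg_trans; apply: near_eq_cvg.
by apply: filterS e => n ->.
Qed.

Lemma cvg_exprn u (a : R) k : u n @[n --> \oo] --> a -> u n ^+ k @[n --> \oo] --> a ^+ k.
Proof.
move=> ua; elim: k => [|k IH].
  by under eq_fun do rewrite expr0; rewrite expr0; exact: cvg_cst.
by under eq_fun do rewrite exprS; rewrite exprS; exact: cvgM.
Qed.

Lemma cvg_sumr (I : Type) (l : seq I) (P : pred I) (F : I -> nat -> R) (a : I -> R) :
  (forall i, P i -> F i n @[n --> \oo] --> a i) ->
  \sum_(i <- l | P i) F i n @[n --> \oo] --> \sum_(i <- l | P i) a i.
Proof.
move=> Fa; elim: l => [|i l IH].
  by under eq_fun do rewrite big_nil; rewrite big_nil; exact: cvg_cst.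
under eq_fun do rewrite big_cons; rewrite big_cons; case: ifP => Pi //.
by apply: cvgD => //; exact: Fa.
Qed.

Lemma cvg_inv_oo u : u n @[n --> \oo] --> +oo -> (u n)^-1 @[n --> \oo] --> (0 : R).
Proof.
move=> uy; apply/(gtr0_cvgV0 (f := u)) => //; exact: cvgry_gt.
Qed.

Lemma cvg_expR u (a : R) : u n @[n --> \oo] --> a -> expR (u n) @[n --> \oo] --> expR a.
Proof. move=> ua; exact: (@continuous_cvg _ _ _ _ _ u (@expR R) a (@continuous_expR R a) ua). Qed.

Lemma cvg_ln_oo u : u n @[n --> \oo] --> +oo -> ln (u n) @[n --> \oo] --> +oo.
Proof.
move=> uy; apply/cvgryPge => A.
apply: filterS (cvgry_ge uy (expR A)) => n le.
rewrite -[A]expRK ler_ln ?posrE ?expR_gt0 //.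
by apply: lt_le_trans le; exact: expR_gt0.
Qed.

(** With u = ln x, this is u / exp u, which is at most 2 / u. *)
Lemma cvg_ln_div_oo u : u n @[n --> \oo] --> +oo -> ln (u n) / u n @[n --> \oo] --> (0 : R).
Proof.
move=> uy; have ly := cvg_ln_oo uy.
have z : (2 * (ln (u n))^-1 @[n --> \oo] --> (0 : R)).
  by rewrite -[X in _ --> X](mulr0 2); apply: cvgMl_tmp; exact: cvg_inv_oo.
apply: (squeeze_cvgr _ (cvg_cst (0 : R)) z).
near=> n; have u0 : 0 < u n by near: n; exact: cvgry_gt.
have l0 : 0 < ln (u n) by near: n; exact: cvgry_gt.
rewrite divr_ge0 ?(ltW u0) ?(ltW l0) //= ler_pdivrMr // mulrAC ler_pdivlMr //.
have := expR_ge1Dxn 1 (ltW l0); rewrite lnK ?posrE // (_ : 2`! = 2%N) // expr2; lra.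
Unshelve. all: by end_near. Qed.

Lemma cvg_nat_oo (s : nat -> nat) : s n @[n --> \oo] --> \oo -> (s n)%:R @[n --> \oo] --> (+oo : set_system R).
Proof. by move=> h; apply/cvgrnyP. Qed.

(** The quotient is the product of the 1 - i / n for i < k. *)
Lemma cvg_binomial k : k`!%:R * 'C(n, k)%:R / n%:R ^+ k @[n --> \oo] --> (1 : R).
Proof.
have inv : (n%:R^-1 : R) @[n --> \oo] --> (0 : R) by apply: cvg_inv_oo; exact: cvgr_idn.
apply: (@cvg_near_eq _ (fun n => \prod_(i < k) (1 - i%:R * n%:R^-1))).
  near=> n; have nk : (k < n)%N by near: n; exact: nbhs_infty_gt.
  have n0 : n%:R != 0 :> R by rewrite pnatr_eq0 -lt0n (leq_ltn_trans _ nk).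
  rewrite -natrM mulnC bin_ffact ffact_prod natr_prod -[X in _ ^+ X]card_ord -prodr_const -prodf_div.
  apply: eq_bigr => i _; rewrite natrB; last by rewrite ltnW // (ltn_trans _ nk).
  by rewrite mulrBl divff.
elim: k => [|k IH].
  by under eq_fun do rewrite big_ord0; exact: cvg_cst.
under eq_fun do rewrite big_ord_recr /=.
have h := cvgM IH (cvgB (cvg_cst (1 : R)) (cvgMl_tmp (a := k%:R) inv)).
rewrite mulr0 subr0 mulr1 in h; exact: h.
Unshelve. all: by end_near. Qed.

End Scales.

(** * The initial clock and the initial predictions *)

Section Asymptotics.
Variables (R : realType) (d : nat) (t : nat -> nat) (gamma eps : R).
Hypothesis d_gt1 : (1 < d)%N.
Hypothesis t_lt : \forall n \near \oo, (t n)%:R < ln (n%:R : R) `^ gamma.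
Hypothesis t_oo : t n @[n --> \oo] --> \oo.

Local Notation L n := (ln (n%:R : R)).

Definition stop_edges n := (maxedges d n - t n)%N.

(** Chosen so that n exp (- r) equals exp (- eps) 2 t (d-1)! / (ln n)^(d-1): the
    clock time at which about 2 t edge ends should be missing, plus eps. *)
Definition start_clock n : R :=
  L n + d.-1%:R * ln (L n) - ln (d.-1`!%:R : R) - ln (2 * (t n)%:R : R) + eps.

(** The predicted number of vertices of degree b with 2 t edge ends missing. For
    b = j it is the Poisson parameter, and for b = d - 1 it is 2 t. *)
Definition typical_count b n : R := 2 * (t n)%:R * d.-1`!%:R / b`!%:R / L n ^+ (d.-1 - b).

Lemma lnn_oo : L n @[n --> \oo] --> +oo.
Proof. by apply: cvg_ln_oo; exact: cvgr_idn. Qed.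

Lemma lnn_inv : (L n)^-1 @[n --> \oo] --> (0 : R).
Proof. by apply: cvg_inv_oo; exact: lnn_oo. Qed.

Lemma tR_oo : (t n)%:R @[n --> \oo] --> (+oo : set_system R).
Proof. exact: cvg_nat_oo. Qed.

Lemma t_gt k : \forall n \near \oo, (k < t n)%N.
Proof. by apply: filterS (cvgry_gt tR_oo k%:R) => n; rewrite ltr_nat. Qed.

Lemma lnt_over_lnn : ln (t n)%:R / L n @[n --> \oo] --> (0 : R).
Proof.
have z : gamma * (ln (L n) / L n) @[n --> \oo] --> (0 : R).
  rewrite -(mulr0 gamma); apply: cvgMl_tmp; apply: cvg_ln_div_oo; exact: lnn_oo.
apply: (squeeze_cvgr _ (cvg_cst (0 : R)) z).
near=> n; have L0 : 0 < L n by near: n; apply: cvgry_gt; exact: lnn_oo.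
have t0 : (0 < t n)%N by near: n; exact: t_gt.
rewrite divr_ge0 ?(ltW L0) ?ln_ge0 ?ler1n //= mulrA ler_wpM2r ?invr_ge0 ?(ltW L0) //.
rewrite -ln_powR ler_ln ?posrE ?ltr0n ?powR_gt0 // ltW //; near: n; exact: t_lt.
Unshelve. all: by end_near. Qed.

Lemma t_le_n : \forall n \near \oo, (t n <= n)%N.
Proof.
have h : \forall n \near \oo, ln (t n)%:R / L n <= (1 : R).
  by apply: (cvgr_le 0) => //; exact: lnt_over_lnn.
near=> n; have L0 : 0 < L n by near: n; apply: cvgry_gt; exact: lnn_oo.
have t0 : (0 < t n)%N by near: n; exact: t_gt.
have n0 : (0 < n)%N by near: n; exact: nbhs_infty_gt.
have : ln (t n)%:R / L n <= 1 by near: n.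
by rewrite ler_pdivrMr // mul1r ler_ln ?posrE ?ltr0n // ler_nat.
Unshelve. all: by end_near. Qed.

(** If d n is odd, one edge end stays free even in a complete run. *)
Lemma stop_edgesE : \forall n \near \oo,
  exists2 q, (d * n = q + 2 * stop_edges n)%N & (2 * t n <= q <= 2 * t n + 1)%N.
Proof.
near=> n; have tn : (t n <= n)%N by near: n; exact: t_le_n.
exists (2 * t n + odd (d * n))%N; last by case: odd; lia.
have := odd_double_half (d * n); rewrite /stop_edges /maxedges -muln2 => e.
have : (n <= (d * n)./2)%N by rewrite -[leqLHS]doubleK half_leq // -muln2 mulnC leq_mul2r d_gt1 orbT.
lia.
Unshelve. all: by end_near. Qed.

(** All corrections are bounded, of order ln (ln n), or ln t, and ln t is at most
    gamma ln (ln n). *)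
Lemma start_clock_ratio : start_clock n / L n @[n --> \oo] --> (1 : R).
Proof.
pose c := - ln (d.-1`!%:R : R) - ln 2 + eps.
apply: (@cvg_near_eq _ _ (fun n => 1 + d.-1%:R * (ln (L n) / L n) + c * (L n)^-1 - ln (t n)%:R / L n)).
  near=> n; have L0 : 0 < L n by near: n; apply: cvgry_gt; exact: lnn_oo.
  have t0 : (0 < t n)%N by near: n; exact: t_gt.
  by rewrite /start_clock /c lnM ?posrE ?ltr0n //; field; rewrite gt_eqF.
have h := cvgB (cvgD (cvgD (cvg_cst (1 : R)) (cvgMl_tmp (a := d.-1%:R) (cvg_ln_div_oo lnn_oo)))
   (cvgMl_tmp (a := c) lnn_inv)) lnt_over_lnn.
rewrite !mulr0 subr0 !addr0 in h; exact: h.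
Unshelve. all: by end_near. Qed.

Lemma start_clock_ge0 : \forall n \near \oo, 0 <= start_clock n.
Proof.
have h : \forall n \near \oo, (0 : R) < start_clock n / L n.
  by apply: (cvgr_gt 1) => //; exact: start_clock_ratio.
near=> n; have L0 : 0 < L n by near: n; apply: cvgry_gt; exact: lnn_oo.
have : 0 < start_clock n / L n by near: n.
by rewrite pmulr_lgt0 ?invr_gt0 // => /ltW.
Unshelve. all: by end_near. Qed.

Lemma n_exp_start_clock : \forall n \near \oo,
  n%:R * expR (- start_clock n) = expR (- eps) * (2 * (t n)%:R * d.-1`!%:R / L n ^+ d.-1).
Proof.
near=> n; have L0 : 0 < L n by near: n; apply: cvgry_gt; exact: lnn_oo.
have t0 : (0 < t n)%N by near: n; exact: t_gt.
have n0 : (0 < n)%N by near: n; exact: nbhs_infty_gt.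
have -> : - start_clock n = - L n + (- (d.-1%:R * ln (L n)) + (ln (d.-1`!%:R : R) + (ln (2 * (t n)%:R : R) + - eps))).
  by rewrite /start_clock; ring.
rewrite !expRD !expRN expRM_natl !lnK ?posrE ?ltr0n ?fact_gt0 ?mulr_gt0 ?ltr0n //.
by field; rewrite !gt_eqF ?ltr0n ?expR_gt0 ?exprn_gt0.
Unshelve. all: by end_near. Qed.

Variables (g : nat -> R) (b : nat).
Hypothesis b_lt : (b < d)%N.
Hypothesis g_above : forall x, (b < x)%N -> g x = 0.

(** The clock is asymptotic to ln n, so the highest power with a nonzero
    coefficient dominates. *)
Lemma poisson_poly_start_clock : poisson_poly d g 0 (start_clock n) / L n ^+ b @[n --> \oo] --> g b / b`!%:R.
Proof.
pose lim (m : 'I_d) : R := if m == b :> nat then g b / b`!%:R else 0.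
have -> : g b / b`!%:R = \sum_(m < d) lim m.
  rewrite (bigD1 (Ordinal b_lt)) //= /lim eqxx big1 ?addr0 // => m mb.
  by rewrite (_ : (m == b :> nat) = false) //; apply: negbTE; apply: contraNneq mb => e; apply/eqP/val_inj.
under eq_fun do rewrite /poisson_poly mulr_suml.
apply: cvg_sumr => m _; rewrite /lim add0n.
case: (ltngtP m b) => mb.
- apply: (@cvg_near_eq _ _ (fun n => g m / m`!%:R * ((start_clock n / L n) ^+ m * (L n)^-1 ^+ (b - m)))).
    near=> n; have L0 : 0 < L n by near: n; apply: cvgry_gt; exact: lnn_oo.
    rewrite -{1}(subnK (ltnW mb)) exprD exprMn !exprVn.
    by field; rewrite !gt_eqF ?exprn_gt0 ?ltr0n ?fact_gt0.
  have h := cvgMl_tmp (a := g m / m`!%:R) (cvgM (cvg_exprn (k := m) start_clock_ratio) (cvg_exprn (k := b - m) lnn_inv)).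
  rewrite expr0n subn_eq0 leqNgt mb /= !mulr0 in h; exact: h.
- rewrite g_above //; under eq_fun do rewrite !mul0r; exact: cvg_cst.
- apply: (@cvg_near_eq _ _ (fun n => g b / b`!%:R * ((start_clock n / L n) ^+ b))).
    near=> n; have L0 : 0 < L n by near: n; apply: cvgry_gt; exact: lnn_oo.
    rewrite mb exprMn exprVn.
    by field; rewrite !gt_eqF ?exprn_gt0 ?ltr0n ?fact_gt0.
  have h := cvgMl_tmp (a := g b / b`!%:R) (cvg_exprn (k := b) start_clock_ratio).
  rewrite expr1n mulr1 in h; exact: h.
Unshelve. all: by end_near. Qed.

Lemma typical_count_gt0 : \forall n \near \oo, 0 < typical_count b n.
Proof.
near=> n; have L0 : 0 < L n by near: n; apply: cvgry_gt; exact: lnn_oo.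
have t0 : (0 < t n)%N by near: n; exact: t_gt.
by rewrite /typical_count !divr_gt0 ?mulr_gt0 ?exprn_gt0 ?ltr0n ?fact_gt0.
Unshelve. all: by end_near. Qed.

Lemma poisson_mean_start_clock :
  n%:R * poisson_mean d g 0 (start_clock n) / typical_count b n @[n --> \oo] --> expR (- eps) * g b.
Proof.
apply: (@cvg_near_eq _ _ (fun n => expR (- eps) * b`!%:R * (poisson_poly d g 0 (start_clock n) / L n ^+ b))).
  near=> n; have L0 : 0 < L n by near: n; apply: cvgry_gt; exact: lnn_oo.
  have t0 : (0 < t n)%N by near: n; exact: t_gt.
  rewrite /poisson_mean mulrA.
  have -> : n%:R * expR (- start_clock n) = expR (- eps) * (2 * (t n)%:R * d.-1`!%:R / L n ^+ d.-1).
    by near: n; exact: n_exp_start_clock.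
  rewrite /typical_count; have e : (d.-1 = b + (d.-1 - b))%N by rewrite subnKC // -ltnS prednK // ltnW.
  rewrite {2}e exprD.
  by field; rewrite !gt_eqF ?exprn_gt0 ?ltr0n ?fact_gt0.
have h := cvgMl_tmp (a := expR (- eps) * b`!%:R) poisson_poly_start_clock.
have e : expR (- eps) * b`!%:R * (g b / b`!%:R) = expR (- eps) * g b.
  by field; rewrite gt_eqF ?ltr0n ?fact_gt0.
rewrite e in h; exact: h.
Unshelve. all: by end_near. Qed.

Hypothesis gP : profile d g.

(** The initial graph has no edges, so its prediction is explicit, and over the
    whole run it changes by a factor exp (O(1/t)) only. *)
Lemma expected_moment_cvg k :
  k`!%:R * expected_moment d n (stop_edges n) (start_clock n) g k / typical_count b n ^+ k
    @[n --> \oo] --> (expR (- eps) * g b) ^+ k.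
Proof.
(* k! times the initial prediction, relative to the k-th power of the typical
   count. *)
pose base n := k`!%:R * 'C(n, k)%:R / n%:R ^+ k *
   (n%:R * poisson_mean d g 0 (start_clock n) / typical_count b n) ^+ k.
have baseC : base n @[n --> \oo] --> (expR (- eps) * g b) ^+ k.
  have h := cvgM (cvg_binomial (R := R) k) (cvg_exprn (k := k) poisson_mean_start_clock).
  rewrite mul1r in h; exact: h.
pose er n : R := drift_error R d k * (t n)%:R^-1.
have er0 : er n @[n --> \oo] --> (0 : R).
  rewrite -(mulr0 (drift_error R d k)); apply: cvgMl_tmp; apply: cvg_inv_oo; exact: tR_oo.
have erE s : expR (s * er n) @[n --> \oo] --> (1 : R).
  rewrite -(expR0 R) -(mulr0 s); apply: cvg_expR; exact: cvgMl_tmp.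
have lo : expR (-1 * er n) * base n @[n --> \oo] --> (expR (- eps) * g b) ^+ k.
  by have h := cvgM (erE (-1)) baseC; rewrite mul1r in h; exact: h.
have hi : expR (1 * er n) * base n @[n --> \oo] --> (expR (- eps) * g b) ^+ k.
  by have h := cvgM (erE 1) baseC; rewrite mul1r in h; exact: h.
apply: (squeeze_cvgr _ lo hi); near=> n.
have n0 : (0 < n)%N by near: n; exact: nbhs_infty_gt.
have sc0 : 0 < typical_count b n by near: n; exact: typical_count_gt0.
have cl0 : 0 <= start_clock n by near: n; exact: start_clock_ge0.
have tb : (4 * d * (k + d + 1) < t n)%N by near: n; exact: t_gt.
have [q dn /andP[q1 _]] : exists2 q, (d * n = q + 2 * stop_edges n)%N & (2 * t n <= q <= 2 * t n + 1)%N.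
  by near: n; exact: stop_edgesE.
have t0 : (0 < t n)%N by apply: leq_trans tb.
have tq : (t n <= q)%N by apply: leq_trans q1; rewrite leq_pmull.
have := @predicted_moment_run R d n g gP 0 (stop_edges n) q k finset.set0 (start_clock n)
  (legal0 d n) cl0 _ (leq_trans tb tq).
rewrite muln0 addn0 => /(_ dn) [r1 r2].
rewrite predicted_moment_init in r1 r2.
set c := drift_error _ _ _ * _ in r1 r2.
have cer : c <= er n.
  rewrite /c /er ler_wpM2l //.
  apply: (@le_trans _ _ (q%:R^-1)); first by rewrite lerBlDr lerDl.
  by rewrite lef_pV2 ?posrE ?ltr0n ?(leq_trans t0 tq) // ler_nat.
have baseE : base n = k`!%:R * ('C(n, k)%:R * poisson_mean d g 0 (start_clock n) ^+ k) / typical_count b n ^+ k.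
  have nk0 : n%:R ^+ k != 0 :> R by rewrite expf_neq0 // pnatr_eq0 -lt0n.
  rewrite /base; move: (typical_count b n) (poisson_mean d g 0 (start_clock n)) => y z.
  rewrite !exprMn exprVn; move: (y ^+ k)^-1 (z ^+ k) => {}y {}z.
  by move: (n%:R ^+ k) nk0 => x x0; field.
have ps0 := poisson_mean_ge0 gP 0 cl0.
have X0 : 0 <= k`!%:R / typical_count b n ^+ k by rewrite divr_ge0 ?exprn_ge0 // ltW.
have C0 : 0 <= 'C(n, k)%:R * poisson_mean d g 0 (start_clock n) ^+ k by rewrite mulr_ge0 ?exprn_ge0.
rewrite baseE mul1r mulN1r.
have comm y z : y * (k`!%:R * z / typical_count b n ^+ k) = k`!%:R / typical_count b n ^+ k * (y * z) by ring.
rewrite !comm [k`!%:R * expected_moment _ _ _ _ _ _ / _]mulrAC.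
apply/andP; split; apply: ler_wpM2l => //.
  by apply: le_trans r1; rewrite ler_wpM2r // ler_expR lerN2.
by apply: le_trans r2 _; rewrite ler_wpM2r // ler_expR.
Unshelve. all: by end_near. Qed.

End Asymptotics.

(** * From degree at most j to degree j *)

Section ExactDegree.
Variables (R : realType) (d n m : nat) (r0 kappa : R) (j i : nat).
Hypothesis r0_ge0 : 0 <= r0.

Definition good_exact : R :=
  clocked d m (fun (G : graph n) (r : R) => ((numdeg G j == i) && (r <= kappa)%R)%:R)
    (fun _ _ => 0) finset.set0 r0.

(** The two events differ only if some vertex has degree less than j; this serves
    when lam is bounded. *)
Lemma good_exact_mass :
  `|good_exact - good_mass d n m r0 kappa j.+1 i| <= good_moment d n m r0 kappa j 1.
Proof.
have pt (G : graph n) (r : R) :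
  `|((numdeg G j == i) && (r <= kappa)%R)%:R - ((#|unsat j.+1 G| == i) && (r <= kappa)%R)%:R|
    <= 'C(#|unsat j G|, 1)%:R * (r <= kappa)%R%:R :> R.
  rewrite card_unsatS bin1; case: (lerP r kappa) => _; rewrite ?andbT ?andbF ?mulr1 ?mulr0 ?subrr ?normr0 //.
  case: (posnP #|unsat j G|) => [->|u0]; first by rewrite add0n subrr normr0.
  apply: (@le_trans _ _ 1); last by rewrite ler1n.
  by case: eqP => _; case: eqP => _; rewrite ?subrr ?subr0 ?sub0r ?normrN ?normr0 ?normr1 ?ler01.
have le1 : good_exact <= 1 * good_mass d n m r0 kappa j.+1 i + 1 * good_moment d n m r0 kappa j 1.
  rewrite /good_mass /good_moment -clocked_lin; apply: run_le => // G r _ _.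
  rewrite !mul1r; have := pt G r; rewrite ler_norml => /andP[_ +]; lra.
have le2 : good_mass d n m r0 kappa j.+1 i <= 1 * good_exact + 1 * good_moment d n m r0 kappa j 1.
  rewrite /good_exact /good_moment -clocked_lin; apply: run_le => // G r _ _.
  rewrite !mul1r; have := pt G r; rewrite ler_norml => /andP[+ _]; lra.
by rewrite ler_norml; apply/andP; split; lra.
Qed.

(** If exactly i vertices have degree j, then either few vertices have degree at
    most j, or many have degree less than j; this serves when lam is large. *)
Lemma good_exact_tail (lam : R) : 0 < lam -> 4 * i%:R <= lam ->
  good_exact <= \sum_(x < n.+1 | x%:R <= lam / 2) good_mass d n m r0 kappa j.+1 x
     + 4 / lam * good_moment d n m r0 kappa j 1.
Proof.
move=> l0 li.
have e : \sum_(x < n.+1 | x%:R <= lam / 2) good_mass d n m r0 kappa j.+1 x =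
   1 * clocked d m
     (fun (G : graph n) r => \sum_(x < n.+1 | x%:R <= lam / 2) 1 * ((#|unsat j.+1 G| == x) && (r <= kappa)%R)%:R)
     (fun G r => \sum_(x < n.+1 | x%:R <= lam / 2) 1 * 0) finset.set0 r0.
  rewrite [RHS]mul1r.
  have h := (clocked_sum d (index_enum 'I_n.+1) (fun x : 'I_n.+1 => x%:R <= lam / 2) (fun=> 1)
    (fun x (G : graph n) r => ((#|unsat j.+1 G| == x) && (r <= kappa)%R)%:R) (fun _ _ _ => 0) m finset.set0 r0).
  by apply: etrans (esym h); apply: eq_bigr => x _; rewrite /= mul1r.
rewrite e /good_moment -clocked_lin; apply: run_le => // [G r _ _|s G r _ _ _]; last first.
  by rewrite big1 ?mulr0 ?addr0 // => x _; rewrite mulr0.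
rewrite mul1r bin1.
have S0 (c : bool) : 0 <= \sum_(x < n.+1 | x%:R <= lam / 2) 1 * ((#|unsat j.+1 G| == x) && c)%:R :> R.
  by apply: sumr_ge0 => x _; rewrite mulr_ge0.
have L0 (c : bool) : 0 <= 4 / lam * (#|unsat j G|%:R * c%:R) by rewrite !mulr_ge0 ?invr_ge0 // ltW.
case: (lerP r kappa) => _; last by rewrite andbF addr_ge0.
rewrite andbT; case: eqP => ni; last by rewrite addr_ge0.
have un : (#|unsat j.+1 G| < n.+1)%N by rewrite ltnS -[leqRHS]card_ord max_card.
case: (lerP (#|unsat j.+1 G|%:R) (lam / 2)) => ul.
  rewrite (bigD1 (Ordinal un)) //= eqxx /= mul1r -addrA lerDl.
  apply: addr_ge0; last exact: (L0 true).
  by apply: sumr_ge0 => x _; rewrite mulr_ge0.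
apply: (@le_trans _ _ (4 / lam * (#|unsat j G|%:R * true%:R))); last by rewrite lerDr S0.
rewrite mulr1 mulrAC ler_pdivlMr // mul1r.
by move: ul; rewrite card_unsatS ni natrD; lra.
Qed.

End ExactDegree.

(** * The clock at the horizon and the factorial moments *)

Section Limits.
Variables (R : realType) (d : nat) (t : nat -> nat) (gamma eps : R).
Hypothesis d_gt1 : (1 < d)%N.
Hypothesis t_lt : \forall n \near \oo, (t n)%:R < ln (n%:R : R) `^ gamma.
Hypothesis t_oo : t n @[n --> \oo] --> \oo.
Hypothesis eps_gt0 : 0 < eps.

Local Notation edges n := (stop_edges d t n).
Local Notation clock n := (start_clock d t eps n).

(** Deficits decay at rate at least 1/d in clock time, so a run with this much left
    on the clock predicts a deficit smaller by exp (- 2 eps), while the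
    prediction is to be smaller by exp (- eps) only. *)
Definition slack : R := 2 * d%:R * eps.

Let d_gt0 : (0 < d)%N. Proof. exact: ltnW. Qed.
Let dR : 0 < d%:R :> R. Proof. by rewrite ltr0n. Qed.

(** With S = 2 t, the predicted deficit concentrates at exp (- eps) S / d. If the clock
    runs out early, at least S edge ends are missing and the prediction is close
    to S / d or larger; if more than [slack] is left at the horizon, it is at most
    exp (- 2 eps) (S + 1) / d. Both are a constant fraction of S away. *)
Lemma bad_prob_cvg : bad_prob d n (edges n) (clock n) slack @[n --> \oo] --> (0 : R).
Proof.
pose x := expR (- eps); have x0 : 0 < x by exact: expR_gt0.
have x1 : x < 1 by rewrite /x expR_lt1 oppr_lt0.
have dm : (d.-1 < d)%N by rewrite prednK.
pose S n := typical_count R d t d.-1 n.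
have SE n : S n = 2 * (t n)%:R.
  by rewrite /S /typical_count subnn expr0 divr1 -mulrA divff ?mulr1 // pnatr_eq0 -lt0n fact_gt0.
pose a := x / d%:R.
pose I k n := expected_moment d n (edges n) (clock n) (deficit R d) k.
have Ic k : k`!%:R * I k n / S n ^+ k @[n --> \oo] --> a ^+ k.
  have ge y : (d.-1 < y)%N -> deficit R d y = 0.
    by move=> dy; case: (deficit_profile R d_gt0) => _ _; apply; lia.
  have h := expected_moment_cvg (eps := eps) d_gt1 t_lt t_oo dm ge (deficit_profile R d_gt0) (k := k).
  rewrite {2}/deficit (_ : d - d.-1 = 1)%N in h; first by rewrite div1r in h; exact: h.
  by lia.
(* The relative gaps are (1 - x) / d early and x (1 - x) / d late; half of the
   smaller one survives the corrections of order 1 / S. *)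
pose c0 := x * (1 - x) / (2 * d%:R).
have c00 : 0 < c0 by rewrite divr_gt0 ?mulr_gt0 //; lra.
pose bound n := (c0 ^+ 2)^-1 *
  (2`!%:R * I 2%N n / S n ^+ 2 + (1`!%:R * I 1%N n / S n ^+ 1) * (S n)^-1
   - 2 * a * (1`!%:R * I 1%N n / S n ^+ 1) + a ^+ 2 * (0`!%:R * I 0%N n / S n ^+ 0)).
have Soo : S n @[n --> \oo] --> +oo.
  apply/cvgryPge => A; apply: filterS (cvgry_ge (cvg_nat_oo (R := R) t_oo) A) => n tA.
  have tn0 : 0 <= (t n)%:R :> R by [].
  by rewrite SE; lra.
have Sinv := cvg_inv_oo Soo.
have boundc : bound n @[n --> \oo] --> (0 : R).
  have h := cvgMl_tmp (a := (c0 ^+ 2)^-1) (cvgD (cvgB (cvgD (Ic 2%N) (cvgM (Ic 1%N) Sinv))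
    (cvgMl_tmp (a := 2 * a) (Ic 1%N))) (cvgMl_tmp (a := a ^+ 2) (Ic 0%N))).
  rewrite (_ : _ * (_ - _ + _) = 0) in h; first exact: h.
  by rewrite expr0 expr1 expr2; ring.
apply: (squeeze_cvgr _ (cvg_cst (0 : R)) boundc); near=> n.
have cl0 : 0 <= clock n by near: n; exact: (start_clock_ge0 d eps t_lt t_oo).
rewrite bad_prob_ge0 //=.
have S4 : 4 * d%:R / (1 - x) <= S n by near: n; exact: cvgry_ge.
have S1 : 4 * d%:R <= (1 - x) * S n.
  by move: S4; rewrite ler_pdivrMr ?subr_gt0 // [leRHS]mulrC.
have S0 : 0 < S n by near: n; exact: cvgry_gt.
have [q dn /andP[q1 q2]] : exists2 q, (d * n = q + 2 * edges n)%N & (2 * t n <= q <= 2 * t n + 1)%N.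
  by near: n; exact: (stop_edgesE d_gt1 t_lt t_oo).
have qS : S n <= q%:R by rewrite SE -natrM ler_nat.
have qS1 : q%:R <= S n + 1 by rewrite SE -natrM natr1 ler_nat -addn1.
have d1 : 1 <= d%:R :> R by rewrite ler1n.
have := @bad_prob_le R d n (edges n) (clock n) d_gt0 cl0 slack (a * S n) (c0 * S n) (mulr_gt0 c00 S0).
move=> /(_ _ _)/le_trans; apply.
- move=> s G r sm lG /andP[r00 rt].
  have sn : (2 * s < d * n)%N by move: (edges n) sm dn => m; clear; lia.
  have := deficit_moment_ge d_gt0 lG r00; have tk := tick_le R lG sn.
  set Q : R := (d * n - 2 * s)%:R in tk *.
  have QS : S n <= Q by apply: le_trans qS _; rewrite ler_nat; move: (edges n) sm dn => m; clear; lia.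
  have Q0 : 0 < Q by apply: lt_le_trans QS.
  have rQ : r * Q <= 2 * d%:R.
    by rewrite -ler_pdivlMr //; apply: le_trans tk; exact: ltW.
  have eQ : Q - 2 * d%:R <= expR (- r) * Q.
    apply: (@le_trans _ _ ((1 - r) * Q)); first by rewrite mulrBl mul1r; lra.
    by rewrite ler_wpM2r ?(ltW Q0) // expR_ge1Dx.
  move=> lb; rewrite lerBrDr; apply: le_trans lb; rewrite /c0 /a [leRHS]mulrA ler_pdivlMr //.
  have -> : (x * (1 - x) / (2 * d%:R) * S n + x / d%:R * S n) * d%:R =
    x * ((1 - x) * S n) / 2 + x * S n by field; rewrite gt_eqF.
  apply: le_trans eQ.
  have : x * ((1 - x) * S n) <= 1 * ((1 - x) * S n).
    by rewrite ler_wpM2r ?(ltW x1) // mulr_ge0 ?(ltW S0) // subr_ge0 ltW.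
  lra.
- move=> G r lG r00 kr; have := deficit_moment_le d_gt0 lG r00.
  have -> : (d * n - 2 * edges n)%:R = q%:R :> R by congr (_%:R); move: (edges n) dn => m; clear; lia.
  have er : expR (- (r / d%:R)) <= x ^+ 2.
    rewrite /x -expRM_natr ler_expR mulNr lerN2 ler_pdivlMr //.
    by apply: le_trans (ltW kr); rewrite /slack; lra.
  have : expR (- (r / d%:R)) * (q%:R / d%:R) <= x ^+ 2 * ((S n + 1) / d%:R).
    by apply: ler_pM; rewrite ?expR_ge0 // ?divr_ge0 // ler_wpM2r // invr_ge0 ltW.
  move=> l1 l2; rewrite lerBrDr; apply: le_trans (lerD (lexx _) (le_trans l2 l1)) _.
  rewrite -(ler_pM2r dR).
  have -> : (c0 * S n + x ^+ 2 * ((S n + 1) / d%:R)) * d%:R = x * ((1 - x) * S n) / 2 + x ^+ 2 * S n + x ^+ 2.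
    by rewrite /c0; field; rewrite gt_eqF.
  have -> : a * S n * d%:R = x * S n by rewrite /a; field; rewrite gt_eqF.
  have : x * 2 <= x * ((1 - x) * S n) by rewrite ler_wpM2l ?(ltW x0) //; lra.
  have : x * x <= x * 1 by rewrite ler_wpM2l ?(ltW x0) // ltW.
  rewrite !expr2; lra.
rewrite -/(I 2%N n) -/(I 1%N n) -/(I 0%N n) /bound (_ : 2`! = 2%N) // (_ : 1`! = 1%N) // (_ : 0`! = 1%N) //.
rewrite le_eqVlt; apply/orP; left; apply/eqP; field.
by rewrite !gt_eqF.
Unshelve. all: by end_near. Qed.

Variable j : nat.
Hypothesis j_lt : (j < d)%N.
Local Notation lam n := (typical_count R d t j n).
Local Notation x := (expR (- eps)).

Lemma below_run_cvg a k : (a <= j.+1)%N ->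
  k`!%:R * expected_moment d n (edges n) (clock n) (below R a) k / lam n ^+ k
    @[n --> \oo] --> (x * below R a j) ^+ k.
Proof.
move=> aj; apply: (expected_moment_cvg d_gt1 t_lt t_oo) => //; last exact: (below_profile R (leq_trans aj j_lt)).
by move=> y jy; rewrite /below ltnNge (leq_trans aj jy).
Qed.

(** On good runs prediction and count differ by a factor of at most
    exp (slack k); the bad runs are truncated at A (1 + lam). The hypotheses on
    eps and A say that the limits of all errors add up to less than delta. *)
Lemma good_moment_close k (A delta : R) : 0 < A ->
  expR (slack * k%:R) * x ^+ k < 1 + delta ->
  1 - x ^+ k + k.+1%:R / A < delta ->
  \forall n \near \oo,
   `| k`!%:R * good_moment d n (edges n) (clock n) slack j.+1 k - lam n ^+ k |
      <= delta * (1 + lam n) ^+ k.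
Proof.
move=> A0 hu hl.
pose w k n := k`!%:R * expected_moment d n (edges n) (clock n) (below R j.+1) k / lam n ^+ k.
have wc l : w l n @[n --> \oo] --> x ^+ l.
  by have h := below_run_cvg (leqnn j.+1) (k := l); rewrite /below ltnSn mulr1 in h; exact: h.
have up : \forall n \near \oo, expR (slack * k%:R) * w k n < 1 + delta.
  by apply: (cvgr_lt _ (cvgMl_tmp (a := expR (slack * k%:R)) (wc k))).
(* The deficiency of the good moment in units of (1 + lam)^k: prediction error,
   truncated part, bad runs. *)
pose u n := `|1 - w k n| + (w k.+1 n + k%:R * w k n) / A + k`!%:R * A ^+ k * bad_prob d n (edges n) (clock n) slack.
have uc : u n @[n --> \oo] --> `|1 - x ^+ k| + (x ^+ k.+1 + k%:R * x ^+ k) / A + k`!%:R * A ^+ k * 0.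
  exact: (cvgD (cvgD (cvg_norm (cvgB (cvg_cst _) (wc k))) (cvgMr_tmp (b := A^-1) (cvgD (wc k.+1) (cvgMl_tmp (a := k%:R) (wc k)))))
    (cvgMl_tmp (a := k`!%:R * A ^+ k) bad_prob_cvg)).
have x1 l : x ^+ l <= 1.
  by apply: exprn_ile1; rewrite ?expR_ge0 // expR_le1 oppr_le0 ltW.
have dn : \forall n \near \oo, u n < delta.
  apply: (cvgr_lt _ uc); rewrite mulr0 addr0 ger0_norm ?subr_ge0 //; apply: le_lt_trans hl.
  rewrite lerD2l ler_wpM2r ?invr_ge0 ?(ltW A0) // -natr1 addrC lerD //.
  by rewrite -[leRHS]mulr1 ler_wpM2l.
near=> n.
have cl0 : 0 <= clock n by near: n; exact: (start_clock_ge0 d eps t_lt t_oo).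
have l0 : 0 < lam n by near: n; exact: typical_count_gt0.
have lE l : l`!%:R * expected_moment d n (edges n) (clock n) (below R j.+1) l = w l n * lam n ^+ l.
  by rewrite /w divfK // gt_eqF // exprn_gt0.
set gm := good_moment _ _ _ _ _ _ _.
have wpos l : 0 <= w l n.
  rewrite /w divr_ge0 ?exprn_ge0 ?(ltW l0) // mulr_ge0 // run_ge0 // => [G r _ r00|s G r _ _ /andP[r00 _]].
    by apply: predicted_moment_ge0 => //; exact: below_profile.
  by apply: predicted_moment_ge0 => //; exact: below_profile.
have lk : lam n ^+ k <= (1 + lam n) ^+ k by rewrite lerXn2r ?nnegrE ?addr_ge0 ?(ltW l0) // lerDr.
have lk0 : 0 <= lam n ^+ k by rewrite exprn_ge0 // ltW.
have f0 : 0 <= k`!%:R :> R by [].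
rewrite ler_norml; apply/andP; split; last first.
  have h1 : k`!%:R * gm <= expR (slack * k%:R) * w k n * lam n ^+ k.
    rewrite -mulrA -lE mulrCA ler_wpM2l //.
    exact: good_moment_le.
  have h2 : expR (slack * k%:R) * w k n * lam n ^+ k <= (1 + delta) * lam n ^+ k.
    by rewrite ler_wpM2r // ltW //; near: n.
  have d0 : 0 <= delta.
    apply: ltW; apply: le_lt_trans hl.
    by rewrite addr_ge0 ?subr_ge0 // divr_ge0 // ltW.
  have : delta * lam n ^+ k <= delta * (1 + lam n) ^+ k by rewrite ler_wpM2l.
  lra.
have un : u n < delta by near: n.
pose B := A * (1 + lam n).
have l1 : 0 < 1 + lam n by rewrite addr_gt0.
have B0 : 0 < B by rewrite mulr_gt0.
have := @expected_moment_le R d n (edges n) (clock n) cl0 slack j.+1 k B j_lt B0.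
move=> /(ler_wpM2l f0); rewrite lE -/gm.
set I1 := expected_moment _ _ _ _ _ k.+1; set I0 := expected_moment _ _ _ _ _ k; set bp := bad_prob _ _ _ _ _.
have -> : k`!%:R * (gm + ((k.+1%:R * I1 + k%:R * I0) / B + B ^+ k * bp)) =
   k`!%:R * gm + ((k.+1`!%:R * I1 + k%:R * (k`!%:R * I0)) / B + k`!%:R * B ^+ k * bp).
  by rewrite factS natrM; ring.
rewrite !lE => h.
have e1 : (w k.+1 n * lam n ^+ k.+1 + k%:R * (w k n * lam n ^+ k)) / B <=
   (w k.+1 n + k%:R * w k n) / A * (1 + lam n) ^+ k.
  rewrite ler_pdivrMr // /B.
  have -> : (w k.+1 n + k%:R * w k n) / A * (1 + lam n) ^+ k * (A * (1 + lam n)) =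
     (w k.+1 n + k%:R * w k n) * ((1 + lam n) ^+ k * (1 + lam n)) by field; rewrite gt_eqF.
  rewrite [k%:R * (_ * lam n ^+ k)]mulrA [leRHS]mulrDl; apply: lerD.
    by rewrite exprSr ler_wpM2l // ler_pM ?(ltW l0) // lerDr.
  have kw : 0 <= k%:R * w k n by apply: mulr_ge0.
  rewrite ler_wpM2l //; apply: le_trans lk _.
  by rewrite ler_peMr ?exprn_ge0 ?(ltW l1) // lerDl ltW.
have e2 : (1 - w k n) * lam n ^+ k <= `|1 - w k n| * (1 + lam n) ^+ k.
  apply: (@le_trans _ _ (`|1 - w k n| * lam n ^+ k)); first by rewrite ler_wpM2r // ler_norm.
  by rewrite ler_wpM2l.
have e3 : k`!%:R * B ^+ k * bp = k`!%:R * A ^+ k * bp * (1 + lam n) ^+ k.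
  by rewrite /B exprMn; ring.
have un2 : u n * (1 + lam n) ^+ k <= delta * (1 + lam n) ^+ k.
  by rewrite ler_wpM2r ?exprn_ge0 ?(ltW l1) // ltW.
move: un2; rewrite /u -/bp 2!mulrDl -e3 => un2.
lra.
Unshelve. all: by end_near. Qed.
End Limits.

(** * Convergence to the Poisson law *)

Section Conclusion.
Variables (R : realType) (d : nat) (t : nat -> nat) (gamma : R).
Hypothesis d_gt1 : (1 < d)%N.
Hypothesis t_lt : \forall n \near \oo, (t n)%:R < ln (n%:R : R) `^ gamma.
Hypothesis t_oo : t n @[n --> \oo] --> \oo.
Variable j : nat.
Hypothesis j_lt : (j < d)%N.
Local Notation lam n := (typical_count R d t j n).

Let dR : 0 < d%:R :> R. Proof. by rewrite ltr0n ltnW. Qed.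

Lemma near_all_le (P : nat -> nat -> Prop) M :
  (forall k, (k <= M)%N -> \forall n \near \oo, P k n) ->
  \forall n \near \oo, forall k, (k <= M)%N -> P k n.
Proof.
elim: M => [|M IH] PM.
  by apply: filterS (PM 0%N isT) => n Pn k; rewrite leqn0 => /eqP ->.
have h1 := IH (fun k kM => PM k (leqW kM)); have h2 := PM M.+1 (leqnn _).
near=> n; move=> k; rewrite leq_eqVlt => /orP[/eqP ->|]; first by near: n.
by rewrite ltnS; move: k; near: n.
Unshelve. all: by end_near. Qed.

(** The first bound needs 2 d eps M below ln (1 + delta), the second eps M
    and (M + 1) / A below delta / 2. *)
Lemma small_shift M (delta : R) : 0 < delta -> exists eps A : R, [/\ 0 < eps, 0 < A &
  forall k, (k <= M)%N ->
    expR (slack d eps * k%:R) * expR (- eps) ^+ k < 1 + delta /\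
    1 - expR (- eps) ^+ k + k.+1%:R / A < delta].
Proof.
move=> delta0; have M0 : 0 < M.+1%:R :> R by rewrite ltr0n.
pose e1 := ln (1 + delta) / (4 * d%:R * M.+1%:R); pose e2 := delta / (4 * M.+1%:R).
have l0 : 0 < ln (1 + delta) by rewrite ln_gt0 // ltrDl.
have e10 : 0 < e1 by rewrite !divr_gt0 ?mulr_gt0.
have e20 : 0 < e2 by rewrite !divr_gt0 ?mulr_gt0.
exists (Num.min e1 e2), (4 * M.+1%:R / delta); split.
- by rewrite lt_min e10.
- by rewrite divr_gt0 ?mulr_gt0.
set eps := Num.min e1 e2 => k kM.
have eps0 : 0 < eps by rewrite lt_min e10.
have le1 : eps <= e1 by rewrite ge_min lexx.
have le2 : eps <= e2 by rewrite ge_min lexx orbT.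
have kR : k%:R <= M.+1%:R :> R by rewrite ler_nat leqW.
have k0 : 0 <= k%:R :> R by [].
rewrite -expRM_natr; split.
  rewrite -expRD -[ltRHS]lnK ?posrE ?addr_gt0 // ltr_expR.
  have : d%:R * eps * k%:R <= d%:R * e1 * M.+1%:R.
    by rewrite -[leLHS]mulrA -[leRHS]mulrA ler_wpM2l ?(ltW dR) //; apply: ler_pM => //; exact: ltW.
  have -> : d%:R * e1 * M.+1%:R = ln (1 + delta) / 4 by rewrite /e1; move: (M.+1%:R : R) M0 => y y0; field; rewrite !gt_eqF.
  have : 0 <= eps * k%:R by rewrite mulr_ge0 // ltW.
  rewrite /slack; lra.
rewrite mulNr; have := expR_ge1Dx (- (eps * k%:R)).
have : eps * k%:R <= e2 * M.+1%:R by apply: ler_pM => //; exact: ltW.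
have -> : e2 * M.+1%:R = delta / 4 by rewrite /e2; move: (M.+1%:R : R) M0 => y y0; field; rewrite gt_eqF.
have : k.+1%:R / (4 * M.+1%:R / delta) <= delta / 4.
  rewrite ler_pdivrMr ?divr_gt0 ?mulr_gt0 //.
  rewrite (_ : delta / 4 * _ = M.+1%:R); last by move: (M.+1%:R : R) => y; field; rewrite gt_eqF.
  by rewrite ler_nat ltnS.
move: (k.+1%:R / _) (eps * k%:R) (expR _) => X Z Y.
lra.
Qed.

(** The indicator of degrees below j vanishes at j, so its predicted mean is of
    smaller order than the count of degree j. *)
Lemma good_mean_below_small (eps eta : R) : 0 < eps -> 0 < eta ->
  \forall n \near \oo,
    good_moment d n (stop_edges d t n) (start_clock d t eps n) (slack d eps) j 1 <= eta * lam n.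
Proof.
move=> eps0 eta0.
have h := below_run_cvg (eps := eps) d_gt1 t_lt t_oo j_lt (leqnSn j) (k := 1).
rewrite {2}/below ltnn mulr0 in h.
have h2 := cvgMl_tmp (a := expR (slack d eps * 1%:R)) h.
rewrite expr1 mulr0 in h2; have h3 := cvgr_le _ (h2 _) eta eta0.
near=> n; have l0 : 0 < lam n by near: n; exact: typical_count_gt0.
have cl0 : 0 <= start_clock d t eps n by near: n; exact: (start_clock_ge0 d eps t_lt t_oo).
apply: le_trans (good_moment_le n (stop_edges d t n) cl0 (slack d eps) 1 (ltnW j_lt)) _.
rewrite -ler_pdivrMr // -mulrA.
have : expR (slack d eps * 1%:R) * (1`!%:R * expected_moment d n (stop_edges d t n) (start_clock d t eps n) (below R j) 1 /
   lam n ^+ 1) <= eta by near: n; exact: h3.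
by rewrite (_ : 1`! = 1%N) // mul1r expr1.
Unshelve. all: by end_near. Qed.

Lemma near_poisson (M : nat) (delta : R) : 0 < delta -> exists2 eps : R, 0 < eps &
  \forall n \near \oo,
    near_poisson_moments n.+1
      (good_mass d n (stop_edges d t n) (start_clock d t eps n) (slack d eps) j.+1)
      M delta (lam n).
Proof.
move=> delta0; have [eps [A [eps0 A0 H]]] := small_shift M delta0.
exists eps => //; apply: near_all_le => k kM.
have [h1 h2] := H k kM.
apply: filterS (good_moment_close (k := k) d_gt1 t_lt t_oo eps0 j_lt A0 h1 h2) => n.
by rewrite good_massE.
Qed.

(** For lam up to a bound B the factorial moments determine the law up to eta. For
    lam above B both terms are small: the Poisson weight is at most (i + 1) / lam, and
    the process has fewer than lam / 2 vertices of degree at most j only with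
    small probability. *)
Lemma exact_degree_poisson i (eta : R) : 0 < eta ->
  \forall n \near \oo,
  `| dproc_Pr R d (stop_edges d t n) (fun G : graph n => numdeg G j == i)
     - expR (- lam n) * lam n ^+ i / i`!%:R | <= eta.
Proof.
move=> eta0.
(* Above B, 4 i <= lam, and the Chebyshev bound 4 / lam together with the
   Poisson weight (i + 1) / lam is at most eta / 8. *)
pose B : R := 4 * i.+1%:R + 8 * (i + 5)%:R / eta.
have i0 : 0 <= i%:R :> R by [].
have B1 : 4 * i.+1%:R <= B by rewrite lerDl divr_ge0 ?mulr_ge0 // ltW.
have B2 : 8 * (i + 5)%:R / eta <= B by rewrite lerDr mulr_ge0.
have B0 : 0 < B by apply: lt_le_trans B1; rewrite mulr_gt0 ?ltr0n.
have e4 : 0 < eta / 4 by rewrite divr_gt0.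
have [M1 [d1 [d10 HP]]] := poisson_of_moments i (ltW B0) e4.
pose delta := Num.min d1 (eta / 320).
have delta0 : 0 < delta by rewrite lt_min d10 divr_gt0.
have dd1 : delta <= d1 by rewrite ge_min lexx.
have dd2 : delta <= eta / 320 by rewrite ge_min lexx orbT.
have [eps eps0 HM] := near_poisson (maxn M1 2) delta0.
pose eta' := Num.min (eta / 32) (eta / (4 * B)).
have eta'0 : 0 < eta' by rewrite lt_min !divr_gt0 ?mulr_gt0.
have ee1 : eta' <= eta / 32 by rewrite ge_min lexx.
have ee2 : eta' <= eta / (4 * B) by rewrite ge_min lexx orbT.
have HY := good_mean_below_small eps0 eta'0.
have e8 : 0 < eta / 8 by rewrite divr_gt0.
have Hb := cvgr_le _ (bad_prob_cvg d_gt1 t_lt t_oo eps0) _ e8.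
near=> n.
have l0 : 0 < lam n by near: n; exact: typical_count_gt0.
have cl0 : 0 <= start_clock d t eps n by near: n; exact: (start_clock_ge0 d eps t_lt t_oo).
have iN : (i < n.+1)%N by apply: ltnW; rewrite ltnS; near: n; exact: nbhs_infty_gt.
have bad : bad_prob d n (stop_edges d t n) (start_clock d t eps n) (slack d eps) <= eta / 8 by near: n; exact: Hb.
have Y : good_moment d n (stop_edges d t n) (start_clock d t eps n) (slack d eps) j 1 <= eta' * lam n by near: n; exact: HY.
have mom : near_poisson_moments n.+1
      (good_mass d n (stop_edges d t n) (start_clock d t eps n) (slack d eps) j.+1)
      (maxn M1 2) delta (lam n) by near: n; exact: HM.
have p0 x : 0 <= good_mass d n (stop_edges d t n) (start_clock d t eps n) (slack d eps) j.+1 x.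
  exact: good_mass_ge0.
have := dproc_Pr_clocked d (stop_edges d t n) (fun G : graph n => numdeg G j == i)
  (fun r => r <= slack d eps) cl0.
rewrite -/(good_exact d n (stop_edges d t n) (start_clock d t eps n) (slack d eps) j i).
move=> /le_trans/(_ bad) PX.
have Y0 := good_moment_ge0 d n (stop_edges d t n) cl0 (slack d eps) j 1.
case: (lerP (lam n) B) => lB.
  have momM : near_poisson_moments n.+1
      (good_mass d n (stop_edges d t n) (start_clock d t eps n) (slack d eps) j.+1) M1 d1 (lam n).
    move=> k kM; apply: le_trans (mom k (leq_trans kM (leq_maxl _ _))) _.
    by rewrite ler_wpM2r // exprn_ge0 // addr_ge0 // ltW.
  have h1 := HP _ _ _ (introT andP (conj (ltW l0) lB)) p0 momM iN.
  have h2 := good_exact_mass d n (stop_edges d t n) (slack d eps) j i cl0.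
  have h3 : eta' * lam n <= eta / 4.
    apply: (@le_trans _ _ (eta / (4 * B) * B)); first by apply: ler_pM => //; exact: ltW.
    by rewrite le_eqVlt; apply/orP; left; apply/eqP; field; rewrite gt_eqF.
  move: PX h1 h2; rewrite !ler_norml => /andP[? ?] /andP[? ?] /andP[? ?].
  apply/andP; split; lra.
have mom2 : near_poisson_moments n.+1
    (good_mass d n (stop_edges d t n) (start_clock d t eps n) (slack d eps) j.+1) 2 delta (lam n).
  by move=> k k2; apply: mom; rewrite (leq_trans k2) // leq_maxr.
have Bi : 4 * (i%:R + 1) <= B by rewrite natr1.
have l1 : 1 <= lam n by lra.
have li : 4 * i%:R <= lam n by lra.
have h1 := lower_tail_of_moments (ltW delta0) l1 p0 mom2.
have h2 := good_exact_tail d n (stop_edges d t n) (slack d eps) j cl0 l0 li.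
have h3 := poisson_pmf_le i l0.
have h4 : 4 / lam n * good_moment d n (stop_edges d t n) (start_clock d t eps n) (slack d eps) j 1 <= eta / 8.
  apply: (@le_trans _ _ (4 / lam n * (eta' * lam n))); first by rewrite ler_wpM2l // divr_ge0 // ltW.
  rewrite (_ : _ * (_ * _) = 4 * eta'); first by lra.
  by field; rewrite gt_eqF.
have h5 : 4 / lam n + i.+1%:R / lam n <= eta / 8.
  rewrite -mulrDl ler_pdivrMr //.
  have : 8 * (i + 5)%:R / eta < lam n by apply: le_lt_trans lB.
  rewrite ltr_pdivrMr // natrD -[i.+1%:R]natr1 => ?; lra.
have h6 : 0 <= expR (- lam n) * lam n ^+ i / i`!%:R.
  by rewrite !mulr_ge0 ?expR_ge0 ?exprn_ge0 ?invr_ge0 // ltW.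
have h7 : 0 <= good_exact d n (stop_edges d t n) (start_clock d t eps n) (slack d eps) j i.
  by apply: run_ge0.
move: PX; rewrite !ler_norml => /andP[? ?]; apply/andP; split; lra.
Unshelve. all: by end_near. Qed.

End Conclusion.

Lemma rate_typical_count (R : realType) d (t : nat -> nat) j n : (j < d)%N ->
  rate R j d (t n) n = typical_count R d t j n.
Proof.
move=> jd; rewrite /rate /typical_count !subn1.
have <- : ((d.-1 ^_ (d.-1 - j)) * j`! = d.-1`!)%N.
  have jd1 : (j <= d.-1)%N by lia.
  by rewrite -{2}(subKn jd1) ffact_fact // leq_subr.
rewrite natrM; congr (_ / _).
by field; rewrite pnatr_eq0 -lt0n fact_gt0.
Qed.

Theorem theorem1p6 (R : realType) (d : nat) (hd : (2 <= d)%N)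
    (j : nat) (hj : (j <= d - 2)%N) (gamma : R) (hgamma : 0 < gamma)
    (t : nat -> nat)
    (ht_lt : \forall n \near \oo, (t n)%:R < ln (n%:R : R) `^ gamma)
    (ht_oo : t n @[n --> \oo] --> \oo)
    (i : nat) :
  (dproc_Pr R d (maxedges d n - t n) (fun G : graph n => numdeg G j == i)
     - expR (- rate R j d (t n) n) * rate R j d (t n) n ^+ i / i`!%:R)
    @[n --> \oo] --> (0 : R).
Proof.
have jd : (j < d)%N by lia.
apply/cvgrPdist_le => eta eta0.
apply: filterS (exact_degree_poisson hd ht_lt ht_oo jd i eta0) => n.
by rewrite sub0r normrN !rate_typical_count.
Qed.
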